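(* Let $\alpha,\beta>0$, let $X_1,\ldots,X_n$ be i.i.d. random variables with $X_i \sim Gamma(\alpha,\beta)$, and define $$\Theta := \Big\{ \lambda = (\lambda_1,\ldots,\lambda_n)^T \;\Big|\; \lambda_i \ge 0 \ \forall i,\ \sum_{i=1}^n \lambda_i = 1\Big\}.$$ Then $$m_n(x) := \min_{\lambda\in\Theta} \Pr\Big(\sum_{i=1}^n \lambda_i X_i < x\Big) = \begin{cases} \Pr\Big(\frac1n\sum_{i=1}^n X_i < x\Big), & x < \frac{\alpha}{\beta},\\ \Pr(X_1 < x), & x > \frac{2\alpha+1}{2\beta},\end{cases}$$ $$M_n(x) := \max_{\lambda\in\Theta} \Pr\Big(\sum_{i=1}^n \lambda_i X_i < x\Big) = \begin{cases} \Pr(X_1 < x), & x < \frac{\alpha}{\beta},\\ \Pr\Big(\frac1n\sum_{i=1}^n X_i < x\Big), & x > \frac{2\alpha+1}{2\beta}.\end{cases}$$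
   Context: $Gamma(\alpha,\beta)$ denotes the gamma distribution with shape $\alpha>0$ and rate $\beta>0$, i.e. with probability density $f(x)=\frac{\beta^{\alpha}}{\Gamma(\alpha)}x^{\alpha-1}e^{-\beta x}$ for $x\ge 0$ and $f(x)=0$ for $x<0$. The number $n\ge 1$ is a positive integer. *)

(* Defs.v *)
From HB Require Import structures.
From mathcomp Require Export all_boot all_order all_algebra.
From mathcomp Require Export all_classical all_reals all_analysis.
Export Order.TTheory GRing.Theory Num.Theory.
Export numFieldNormedType.Exports.

Set Implicit Arguments.
Unset Strict Implicit.
Unset Printing Implicit Defensive.

Local Open Scope classical_set_scope.
Local Open Scope ring_scope.

(* Euler's Gamma function, meaningful for 0 < a: for a <= 0 the integral
   diverges and [Rintegral] returns the junk value 0. *)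
Definition Gamma_fun (R : realType) (a : R) : R :=
  \int[lebesgue_measure]_(t in `]0, +oo[) (t `^ (a - 1) * expR (- t)).

(* [b] is the rate, not the scale. At x = 0 and a < 1 the density is infinite;
   here it gets the value 0, which does not affect integrals. *)
Definition gamma_pdf (R : realType) (a b : R) : R -> R :=
  (fun x => b `^ a / Gamma_fun a * x `^ (a - 1) * expR (- b * x))
    \_ `[0, +oo[.

Definition gamma_prob (R : realType) (a b : R) (V : set R) : \bar R :=
  (\int[lebesgue_measure]_(x in V) (gamma_pdf a b x)%:E)%E.

Definition gamma_distributed d (T : measurableType d) (R : realType)
    (P : probability T R) (a b : R) (X : {RV P >-> R}) : Prop :=
  forall V : set R, measurable V -> distribution P X V = gamma_prob a b V.

Definition mutually_independent d (T : measurableType d) (R : realType)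
    (P : probability T R) (I : finType) (X : I -> {RV P >-> R}) : Prop :=
  forall (J : {set I}) (B : I -> set R), (forall i, measurable (B i)) ->
    P (\bigcap_(i in [set` J]) X i @^-1` B i) =
    (\prod_(i in J) P (X i @^-1` B i))%E.

Definition Theta (R : realType) (n : nat) : set 'cV[R]_n :=
  [set lambda | (forall i, 0 <= lambda i ord0) /\
                \sum_(i < n) lambda i ord0 = 1].
Arguments Theta : clear implicits.

Definition prob_lin_lt d (T : measurableType d) (R : realType)
    (P : probability T R) (n : nat) (X : 'I_n -> {RV P >-> R})
    (x : R) (lambda : 'cV[R]_n) : \bar R :=
  P [set w | \sum_(i < n) lambda i ord0 * X i w < x].

Definition is_min (R : realType) (A : set (\bar R)) (v : \bar R) : Prop :=
  A v /\ lbound A v.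

Definition is_max (R : realType) (A : set (\bar R)) (v : \bar R) : Prop :=
  A v /\ ubound A v.

(* The minimum and maximum over Theta, as total functions: an infimum and a
   supremum, to be accompanied by a proof that they are attained. *)
Definition m_n d (T : measurableType d) (R : realType) (P : probability T R)
    (n : nat) (X : 'I_n -> {RV P >-> R}) (x : R) : \bar R :=
  ereal_inf (prob_lin_lt X x @` Theta R n).

Definition M_n d (T : measurableType d) (R : realType) (P : probability T R)
    (n : nat) (X : 'I_n -> {RV P >-> R}) (x : R) : \bar R :=
  ereal_sup (prob_lin_lt X x @` Theta R n).

(* Main.v *)
From HB Require Import structures.
Require Import Defs.
From mathcomp Require Import measurable_realfun ring lra.

Set Implicit Arguments.
Unset Strict Implicit.
Unset Printing Implicit Defensive.

Local Open Scope classical_set_scope.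
Local Open Scope ring_scope.

(** Scaling by the rate and taking positive parts changes no probability, so
    let the variables [Y k] be nonnegative gamma variables of rate 1, and let
    [F] be the distribution function of the sum [S] of the [lam k * Y k].  The
    weight vectors form a compact simplex on which the value of [F] at [x] is
    continuous, so a minimizer and a maximizer exist ([weights_argmin]); it
    remains to see that all other weights fail to be extremal.

    For this, two weights are moved while their sum stays fixed.  When [lam i]
    grows at the expense of [lam j], the derivative of [F x] is
    [alpha * (lam i - lam j) * h' x] ([pair_derive]), where [h] is the density
    of [S + lam i * E + lam j * E'] with [E], [E'] standard exponential and
    everything independent.  This [h] increases up to a mode and decreases
    after it ([mode_exists]).  Hence, when [lam j < lam i], spreading the two
    weights apart raises [F x] if [x] lies below the mode and lowers it if [x]
    lies above.  The mode is at least [alpha] as soon as no weight exceeds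
    [lam i + lam j] ([density_increasing]), and at most [alpha + 1 / 2] for a
    suitable pair ([density_decreasing], [density_decreasing_one_large]).  So
    below [alpha] a minimizer has all weights equal and a maximizer has a
    single nonzero weight; above [alpha + 1 / 2] the roles are exchanged.  For
    rate [beta] these two thresholds become those of the theorem.

    Two tools give all that is needed about [h].  The first is the operator
    [esmooth l], which sends the distribution function of [Z] to that of
    [Z + l * E]; it inverts [g |-> l * g' + g] among the functions vanishing on
    the negative half-line, so that comparison arguments for this first-order
    equation replace computations with convolutions.  The second is the size
    bias of the gamma law: weighting [Y k] by its own value amounts to adding
    an independent exponential variable.  For the density [h], with
    [a k = alpha + (k == i) + (k == j)], it reads
      [x * h x = \sum_k a k * lam k * esmooth (lam k) h x],
    and its derivative is
      [h x + x * h' x = \sum_k a k * (h x - esmooth (lam k) h x)].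
    At the mode [m], put [psi k = 1 - esmooth (lam k) h m / h m].  The numbers
    [a k * psi k] are nonnegative and sum to 1, [psi k] is nondecreasing as a
    function of [lam k], and [m = alpha + lam i + lam j] minus the mean of the
    [lam k] for these probabilities ([mode_facts]).  The bounds on the mode are
    bounds on that mean.  When one weight exceeds 1/2 and all others are equal,
    comparing weights does not suffice; there [h] is the density of a
    combination of two gamma variables, and the monotonicity of the conditional
    share of one of them ([share_nondecreasing]) gives the missing estimate. *)

(** * Monotonicity from derivatives *)

Section Calculus.
Context {R : realType}.
Implicit Types f : R -> R.

Lemma is_derive_continuous f (x df : R) :
  is_derive x 1 f df -> {for x, continuous f}.
Proof.
by move=> d; apply/differentiable_continuous/derivable1_diffP; exact: ex_derive.
Qed.

Lemma derive_ge0_le f df (a b : R) : a <= b -> {within `[a, b], continuous f} ->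
  (forall x, a < x < b -> is_derive x 1 f (df x)) ->
  (forall x, a < x < b -> 0 <= df x) -> f a <= f b.
Proof.
move=> ab cf df1 df0; move: ab; rewrite le_eqVlt => /predU1P[->//|ab].
have df1' x : x \in `]a, b[ -> is_derive x 1 f (df x) by rewrite in_itv; exact: df1.
have [c + E] := MVT ab df1' cf; rewrite in_itv /= => cab.
by rewrite -subr_ge0 E mulr_ge0 ?df0 // subr_ge0 ltW.
Qed.

Lemma derive_gt0_lt f df (a b : R) : a < b -> {within `[a, b], continuous f} ->
  (forall x, a < x < b -> is_derive x 1 f (df x)) ->
  (forall x, a < x < b -> 0 < df x) -> f a < f b.
Proof.
move=> ab cf df1 df0.
have df1' x : x \in `]a, b[ -> is_derive x 1 f (df x) by rewrite in_itv; exact: df1.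
have [c + E] := MVT ab df1' cf; rewrite in_itv /= => cab.
by rewrite -subr_gt0 E mulr_gt0 ?df0 // subr_gt0.
Qed.

Lemma derive_gt0_near f (x d : R) : is_derive x 1 f d -> 0 < d ->
  exists2 e, 0 < e & forall z, (x < z < x + e -> f x < f z) /\
                               (x - e < z < x -> f z < f x).
Proof.
move=> /is_derive1_caratheodory[g [E cg gx]] d0.
have /nbhs_ballP[e /= e0 ge] : \forall z \near x, 0 < g z.
  by move/cvgr_gt : cg; apply; rewrite gx.
exists e => // z; split=> /andP[z1 z2]; rewrite -subr_gt0.
- by rewrite E mulr_gt0 ?subr_gt0 //; apply: ge; rewrite /ball /= ltr_distlC; lra.
- rewrite -opprB oppr_gt0 E pmulr_rlt0 ?subr_lt0 //.
  by apply: ge; rewrite /ball /= ltr_distlC; lra.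
Qed.

Lemma derive_lt0_near f (x d : R) : is_derive x 1 f d -> d < 0 ->
  exists2 e, 0 < e & forall z, (x < z < x + e -> f z < f x) /\
                               (x - e < z < x -> f x < f z).
Proof.
move=> df d0; have dNf : is_derive x 1 (fun y => - f y) (- d).
  by apply: is_derive_eq.
have [|e e0 H] := derive_gt0_near dNf; first by rewrite oppr_gt0.
by exists e => // z; have [H1 H2] := H z; split=> /[dup] zz; [move=> /H1|move=> /H2];
  rewrite ltrN2.
Qed.

(** The mean value theorem for an increment of either sign; the intermediate
    point is located by its distance to [t] only, which is what passes to the
    limit when the increment tends to 0. *)
Lemma mvt_near (f df : R -> R) (t u : R) :
  (forall z, `|z - t| <= `|u| -> is_derive z 1 f (df z)) ->
  exists2 c, `|c - t| <= `|u| & f (t + u) - f t = df c * u.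
Proof.
move=> dff; have cf (a b : R) : `|a - t| <= `|u| -> `|b - t| <= `|u| ->
    {within `[a, b], continuous f}.
  move=> at_ bt; apply: continuous_in_subspaceT => z; rewrite inE /= in_itv /= => zab.
  apply: is_derive_continuous (dff z _).
  by move: at_ bt; rewrite !ler_norml; lra.
have [u0|u0|u0] := ltgtP 0 u.
- have dI y : y \in `]t, t + u[ -> is_derive y 1 f (df y).
    by rewrite in_itv /= => ytu; apply: dff; rewrite (gtr0_norm u0) ler_norml; lra.
  have [||c] := @MVT _ f df t (t + u) _ dI; first by rewrite ltrDl.
    by apply: cf; rewrite ?subrr ?normr0 // addrC addKr.
  rewrite in_itv /= => cI E; exists c; last by rewrite E addrC addKr.
  by rewrite (gtr0_norm u0) ler_norml; lra.
- have dI y : y \in `]t + u, t[ -> is_derive y 1 f (df y).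
    by rewrite in_itv /= => ytu; apply: dff; rewrite (ltr0_norm u0) ler_norml; lra.
  have [||c] := @MVT _ f df (t + u) t _ dI; first by rewrite gtrDl.
    by apply: cf; rewrite ?subrr ?normr0 // addrC addKr.
  rewrite in_itv /= => cI E; exists c.
    by rewrite (ltr0_norm u0) ler_norml; lra.
  by rewrite -opprB E; ring.
- by exists t; rewrite -?u0 ?subrr ?normr0 // addr0 subrr mulr0.
Qed.

Lemma cvg_dist_le (c u : nat -> R) (t : R) : (forall n, `|c n - t| <= `|u n|) ->
  u n @[n --> \oo] --> (0 : R) -> c n @[n --> \oo] --> t.
Proof.
move=> cu u0; apply/subr_cvg0; apply: norm_cvg0.
apply: (@squeeze_cvgr _ _ _ _ (cst 0) (fun n => `|u n|)).
- by apply: nearW => n; rewrite normr_ge0 cu.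
- exact: cvg_cst.
- by rewrite -(normr0 R); exact: cvg_norm.
Qed.

End Calculus.

(** * Exponential smoothing *)

Definition causal (R : realType) (f : R -> R) : Prop :=
  continuous f /\ forall x, x <= 0 -> f x = 0.

HB.lock Definition prim (R : realType) (f : R -> R) (x : R) : R :=
  \int[lebesgue_measure]_(t in `]-oo, x]) f t.

(** For [0 < l] this is the convolution of [f] with the exponential law of mean
    [l]; a point mass at 0, hence the identity, for [l = 0]. *)
HB.lock Definition esmooth (R : realType) (l : R) (f : R -> R) (x : R) : R :=
  if l == 0 then f x
  else l^-1 * expR (- (x / l)) * prim (fun s => f s * expR (s / l)) x.

Section Smoothing.
Context {R : realType}.
Implicit Types (f g w : R -> R) (x l : R).

Lemma causal_integrable f x : causal f ->
  (@lebesgue_measure R).-integrable `]-oo, x] (EFin \o f).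
Proof.
move=> [cf f0].
have mf : measurable_fun setT f by exact: continuous_measurable_fun.
have [x0|x0] := leP 0 x; last first.
  apply: (eq_integrable _ (cst 0%E)) => //=; last exact: integrable0.
  by move=> y; rewrite inE /= in_itv /= => yx; rewrite f0 // (le_trans yx) // ltW.
apply/integrable_mkcond => //.
have -> : (EFin \o f) \_ `]-oo, x] = (EFin \o f) \_ `[0, x].
  apply/funext => y; rewrite /patch; case: ifPn => yx; case: ifPn => yx' //=.
  - rewrite f0 //; move: yx yx'; rewrite !mem_setE !in_itv /= => ->.
    by rewrite andbT -ltNge => /ltW.
  - by move: yx yx'; rewrite !mem_setE !in_itv /= => /negPf ->; rewrite andbF.
apply/(integrable_mkcond _ _).1 => //; apply: continuous_compact_integrable.
  exact: segment_compact.
exact: continuous_subspaceT.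
Qed.

Lemma is_derive_prim f x : causal f -> is_derive x 1 (prim f) (f x).
Proof.
move=> cf; have x1 : x < x + 1 by rewrite ltrDl.
have cx : {for x, continuous f} by case: cf => + _; apply.
have /= H := continuous_FTC1 x1 (causal_integrable (x + 1) cf).
have [d fx] := H (ltNyr x) cx.
by rewrite prim.unlock; apply: (DeriveDef d); rewrite -derive1E.
Qed.

Lemma causal_prim f : causal f -> causal (prim f).
Proof.
move=> cf; split=> x; first exact: (is_derive_continuous (is_derive_prim x cf)).
move=> x0; rewrite prim.unlock (@eq_Rintegral _ _ _ _ _ (cst 0)).
  by rewrite Rintegral_cst //= mul0r.
by move=> y; rewrite inE /= in_itv /= => yx; case: cf => _ ->//; exact: le_trans x0.
Qed.

Let is_derive_expRM l x : is_derive x 1 (fun x => expR (x / l)) (l^-1 * expR (x / l)).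
Proof.
have dl : is_derive x 1 (fun x => x / l) l^-1.
  by apply: is_derive_eq; rewrite /GRing.scale /= mulr0 add0r mulr1.
by rewrite mulrC; exact: (@is_derive1_comp _ expR _ x _ _ (is_derive_expR _) dl).
Qed.

Let continuous_expRM l : continuous (fun x : R => expR (x / l)).
Proof. by move=> x; exact: is_derive_continuous (is_derive_expRM l x). Qed.

Let relax_derive l w x (d : R) : 0 < l -> is_derive x 1 w d ->
  is_derive x 1 (fun x => w x * expR (x / l))
    ((l * d + w x) / l * expR (x / l)).
Proof.
move=> l0 dw; have dE := is_derive_expRM l x.
by apply: is_derive_eq; rewrite /GRing.scale /=; field; rewrite gt_eqF.
Qed.

Let relax_continuous l w m : {within `[0, m], continuous w} ->
  {within `[0, m], continuous (fun x => w x * expR (x / l))}.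
Proof.
move=> cw x; apply: cvgM; first exact: cw.
by apply: continuous_subspaceT; exact: continuous_expRM.
Qed.

(** Comparison principle for [l * w' + w]: its sign is that of the derivative of
    [w x * expR (x / l)]. *)
Lemma relax_ge l w w' m : 0 < l -> 0 <= m -> {within `[0, m], continuous w} ->
  (forall x, 0 < x < m -> is_derive x 1 w (w' x)) ->
  (forall x, 0 < x < m -> 0 <= l * w' x + w x) -> w 0 <= w m * expR (m / l).
Proof.
move=> l0 m0 cw dw H; have := @relax_continuous l _ _ cw.
move=> /(derive_ge0_le m0)/(_ (fun x xm => relax_derive l0 (dw x xm))).
rewrite mul0r expR0 mulr1; apply => x xm.
by rewrite mulr_ge0 ?expR_ge0 // divr_ge0 ?H // ltW.
Qed.

Lemma relax_ge0 l w w' m : 0 < l -> 0 <= m -> {within `[0, m], continuous w} ->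
  (forall x, 0 < x < m -> is_derive x 1 w (w' x)) ->
  (forall x, 0 < x < m -> 0 <= l * w' x + w x) -> 0 <= w 0 -> 0 <= w m.
Proof.
move=> l0 m0 cw dw H w0; have := le_trans w0 (relax_ge l0 m0 cw dw H).
by rewrite pmulr_lge0 // expR_gt0.
Qed.

Lemma relax_gt0 l w w' m : 0 < l -> 0 <= m -> {within `[0, m], continuous w} ->
  (forall x, 0 < x < m -> is_derive x 1 w (w' x)) ->
  (forall x, 0 < x < m -> 0 <= l * w' x + w x) -> 0 < w 0 -> 0 < w m.
Proof.
move=> l0 m0 cw dw H w0; have := lt_le_trans w0 (relax_ge l0 m0 cw dw H).
by rewrite pmulr_lgt0 // expR_gt0.
Qed.

Lemma relax_gt0_source l w w' m : 0 < l -> 0 < m -> {within `[0, m], continuous w} ->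
  (forall x, 0 < x < m -> is_derive x 1 w (w' x)) ->
  (forall x, 0 < x < m -> 0 < l * w' x + w x) -> 0 <= w 0 -> 0 < w m.
Proof.
move=> l0 m0 cw dw H w0.
have : w 0 < w m * expR (m / l).
  have := @relax_continuous l _ _ cw.
  move=> /(derive_gt0_lt m0)/(_ (fun x xm => relax_derive l0 (dw x xm))).
  rewrite mul0r expR0 mulr1; apply => x xm.
  by rewrite mulr_gt0 ?expR_gt0 // divr_gt0 ?H.
by move=> /(le_lt_trans w0); rewrite pmulr_lgt0 // expR_gt0.
Qed.

Lemma esmooth0 f : esmooth 0 f = f.
Proof. by apply/funext => x; rewrite esmooth.unlock eqxx. Qed.

Let causal_kernel l f : causal f -> causal (fun s => f s * expR (s / l)).
Proof.
move=> [cf f0]; split=> x; last by move=> /f0->; rewrite mul0r.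
by apply: cvgM; [exact: cf|exact: continuous_expRM].
Qed.

Lemma is_derive_esmooth l f x : 0 < l -> causal f ->
  is_derive x 1 (esmooth l f) ((f x - esmooth l f x) / l).
Proof.
move=> l0 cf; have dp := is_derive_prim x (causal_kernel l cf).
have dE : is_derive x 1 (fun x => expR (- (x / l))) (- l^-1 * expR (- (x / l))).
  have -> : (fun x => expR (- (x / l))) = (fun x => expR (x / - l)).
    by apply/funext => y; rewrite invrN mulrN.
  by apply: is_derive_eq (is_derive_expRM _ _) _; rewrite invrN mulrN.
have -> : esmooth l f = (fun x => l^-1 * expR (- (x / l)) *
    prim (fun s => f s * expR (s / l)) x).
  by apply/funext => y; rewrite esmooth.unlock gt_eqF.
have E : expR (- (x / l)) * expR (x / l) = 1 by rewrite -expRD addNr expR0.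
apply: is_derive_eq; rewrite /GRing.scale /=.
set p := prim _ _; set e := expR (- _) in E *; set e' := expR _ in E *.
have -> : l^-1 * e * (f x * e') = f x * (e * e') / l by ring.
rewrite E; field; by rewrite gt_eqF.
Qed.

Lemma causal_esmooth l f : 0 <= l -> causal f -> causal (esmooth l f).
Proof.
rewrite le_eqVlt => /predU1P[<-|l0 cf]; first by rewrite esmooth0.
split=> x; first exact: is_derive_continuous (is_derive_esmooth x l0 cf).
move=> x0; rewrite esmooth.unlock gt_eqF //.
by case: (causal_prim (causal_kernel l cf)) => _ ->; rewrite ?mulr0.
Qed.

(** The difference of two solutions of [l * g' + g = f] satisfies the homogeneous
    equation with value 0 at 0, and the comparison principle bounds it from both
    sides.  Most later identities about [esmooth] are obtained from it, by checking
    the differential equation for a candidate. *)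
Lemma esmooth_uniq l f g g' : 0 <= l -> causal f -> causal g ->
  (forall x, 0 < x -> is_derive x 1 g (g' x)) ->
  (forall x, 0 < x -> l * g' x + g x = f x) -> g = esmooth l f.
Proof.
move=> l0 cf cg dg H; apply/funext => x.
have [x0|x0] := leP x 0.
  by case: cg => _ ->//; have [_ ->] := causal_esmooth l0 cf.
move: l0; rewrite le_eqVlt => /predU1P[l0|l0].
  by rewrite -l0 esmooth0 -H // -l0 mul0r add0r.
have [ce e0] := causal_esmooth (ltW l0) cf; case: cg => cg g0.
apply/eqP; rewrite eq_le; apply/andP; split; rewrite -subr_ge0.
- apply: (@relax_ge0 l (fun x => esmooth l f x - g x)
    (fun x => (f x - esmooth l f x) / l - g' x)) (ltW x0) _ _ _ _ => //.
  + apply: continuous_subspaceT => y.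
    by apply: cvgB; [exact: ce|exact: cg].
  + move=> y /andP[y0 _]; apply: is_deriveB; [exact: is_derive_esmooth|exact: dg].
  + move=> y /andP[y0 _]; rewrite -(H y y0) le_eqVlt; apply/orP; left; apply/eqP.
    by field; rewrite gt_eqF.
  + by rewrite e0 // g0 // subrr.
- apply: (@relax_ge0 l (fun x => g x - esmooth l f x)
    (fun x => g' x - (f x - esmooth l f x) / l)) (ltW x0) _ _ _ _ => //.
  + apply: continuous_subspaceT => y.
    by apply: cvgB; [exact: cg|exact: ce].
  + move=> y /andP[y0 _]; apply: is_deriveB; [exact: dg|exact: is_derive_esmooth].
  + move=> y /andP[y0 _]; rewrite -(H y y0) le_eqVlt; apply/orP; left; apply/eqP.
    by field; rewrite gt_eqF.
  + by rewrite e0 // g0 // subrr.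
Qed.

Lemma causalB f g : causal f -> causal g -> causal (fun x => f x - g x).
Proof.
move=> [cf f0] [cg g0]; split=> x; first by apply: cvgB; [exact: cf|exact: cg].
by move=> x0; rewrite f0 // g0 // subrr.
Qed.

Lemma causalZ (c : R) f : causal f -> causal (fun x => c * f x).
Proof.
move=> [cf f0]; split=> x; last by move=> x0; rewrite f0 // mulr0.
by apply: cvgM; [exact: cvg_cst|exact: cf].
Qed.

Lemma esmoothC l1 l2 f : 0 <= l1 -> 0 <= l2 -> causal f ->
  esmooth l1 (esmooth l2 f) = esmooth l2 (esmooth l1 f).
Proof.
rewrite le_eqVlt => /predU1P[<-|l10]; first by rewrite !esmooth0.
rewrite le_eqVlt => /predU1P[<-|l20]; first by rewrite !esmooth0.
move=> cf; have cp := causal_esmooth (ltW l20) cf.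
have cq := causal_esmooth (ltW l10) cp.
(* [z] is [l2 * g' + g] for [g = esmooth l1 (esmooth l2 f)]; it solves the equation
   that defines [esmooth l1 f], so [g] solves the one for [esmooth l2]. *)
pose z x := l2 * ((esmooth l2 f x - esmooth l1 (esmooth l2 f) x) / l1) +
  esmooth l1 (esmooth l2 f) x.
have zE : z = esmooth l1 f.
  apply: (@esmooth_uniq _ _ _ (fun x => l2 * (((f x - esmooth l2 f x) / l2 -
    (esmooth l2 f x - esmooth l1 (esmooth l2 f) x) / l1) / l1)
    + (esmooth l2 f x - esmooth l1 (esmooth l2 f) x) / l1)) => //.
  - exact: ltW.
  - have [cz z0] := causalZ (l2 / l1) (causalB cp cq).
    split=> x; last by move=> x0; rewrite /z; case: cq => _ ->//; case: cp => _ ->//; ring.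
    apply: (@continuousD _ _ _
      (fun x => l2 * ((esmooth l2 f x - esmooth l1 (esmooth l2 f) x) / l1)));
      last by case: cq => + _; apply.
    rewrite (_ : (fun x => _) = (fun x => l2 / l1 *
      (esmooth l2 f x - esmooth l1 (esmooth l2 f) x))); first exact: cz.
    by apply/funext => y; ring.
  - move=> x x0; have ? := is_derive_esmooth x l20 cf.
    have ? := is_derive_esmooth x l10 cp.
    rewrite /z; apply: is_derive_eq; rewrite /GRing.scale /=; ring.
  - move=> x x0; rewrite /z; field; by rewrite !gt_eqF.
by apply: (esmooth_uniq (ltW l20) _ cq (fun x _ => is_derive_esmooth x l10 cp));
  [exact: causal_esmooth (ltW l10) cf|move=> x x0; rewrite -zE].
Qed.

Lemma is_derive_esmooth_comm l f f' x : 0 <= l -> causal f -> causal f' ->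
  (forall x, is_derive x 1 f (f' x)) ->
  is_derive x 1 (esmooth l f) (esmooth l f' x).
Proof.
rewrite le_eqVlt => /predU1P[<-|l0]; first by rewrite !esmooth0.
move=> cf cf' df; suff <- : (fun x => l^-1 * (f x - esmooth l f x)) = esmooth l f'.
  by rewrite mulrC; exact: is_derive_esmooth.
apply: (@esmooth_uniq _ _ _ (fun x => l^-1 * (f' x - (f x - esmooth l f x) / l))) => //.
- exact: ltW.
- by apply: causalZ; apply: causalB => //; apply: causal_esmooth => //; exact: ltW.
- move=> y y0; have ? := df y; have ? := is_derive_esmooth y l0 cf.
  by apply: is_derive_eq; rewrite /GRing.scale /=; ring.
- by move=> y y0; field; rewrite gt_eqF.
Qed.

(** Smoothing averages [f] over the past, so at a record of [f] the average stays
    below [f]; strictly, because the memory reaches the value 0 at 0. *)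
Lemma esmooth_lt l f m : 0 < l -> 0 <= m -> causal f -> 0 < f m ->
  (forall x, 0 < x < m -> f x <= f m) -> esmooth l f m < f m.
Proof.
move=> l0 m0 cf fm H; rewrite -subr_gt0.
have [ce e0] := causal_esmooth (ltW l0) cf.
apply: (@relax_gt0 l (fun x => f m - esmooth l f x)
  (fun x => - ((f x - esmooth l f x) / l))) m0 _ _ _ _ => //.
- apply: continuous_subspaceT => y.
  by apply: cvgB; [exact: cvg_cst|exact: ce].
- move=> y _; have ? := is_derive_esmooth y l0 cf.
  by apply: is_derive_eq; ring.
- move=> y ym; suff -> : l * - ((f y - esmooth l f y) / l) + (f m - esmooth l f y) = f m - f y.
    by rewrite subr_ge0 H.
  by field; rewrite gt_eqF.
- by rewrite e0 // subr0.
Qed.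

Lemma esmooth_le l f m : 0 <= l -> 0 <= m -> causal f -> 0 <= f m ->
  (forall x, 0 < x < m -> f x <= f m) -> esmooth l f m <= f m.
Proof.
rewrite le_eqVlt => /predU1P[<-|l0]; first by rewrite !esmooth0.
move=> m0 cf fm H; rewrite -subr_ge0.
have [ce e0] := causal_esmooth (ltW l0) cf.
apply: (@relax_ge0 l (fun x => f m - esmooth l f x)
  (fun x => - ((f x - esmooth l f x) / l))) m0 _ _ _ _ => //.
- apply: continuous_subspaceT => y.
  by apply: cvgB; [exact: cvg_cst|exact: ce].
- move=> y _; have ? := is_derive_esmooth y l0 cf.
  by apply: is_derive_eq; ring.
- move=> y ym; suff -> : l * - ((f y - esmooth l f y) / l) + (f m - esmooth l f y) = f m - f y.
    by rewrite subr_ge0 H.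
  by field; rewrite gt_eqF.
- by rewrite e0 // subr0.
Qed.

(** For a nondecreasing [f], a longer memory gives more weight to smaller values. *)
Lemma esmooth_anti l1 l2 f m : 0 <= l1 -> l1 <= l2 -> 0 <= m -> causal f ->
  (forall x y, 0 <= x -> x <= y -> y <= m -> f x <= f y) ->
  esmooth l2 f m <= esmooth l1 f m.
Proof.
move=> l10 l12 m0 cf fm; have f0 : f 0 = 0 by case: cf => _ ->.
have le_f x : 0 <= x -> x <= m -> esmooth l2 f x <= f x.
  move=> x0 xm; apply: esmooth_le => //; first exact: le_trans l12.
    by rewrite -f0 fm.
  by move=> y /andP[y0 yx]; rewrite fm // ltW.
move: l10; rewrite le_eqVlt => /predU1P[l1_0|l10].
  by rewrite -l1_0 esmooth0 le_f.
have l20 := lt_le_trans l10 l12.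
have [ce e0] := causal_esmooth (ltW l10) cf.
have [ce' e0'] := causal_esmooth (ltW l20) cf.
rewrite -subr_ge0; apply: (@relax_ge0 l1 (fun x => esmooth l1 f x - esmooth l2 f x)
  (fun x => (f x - esmooth l1 f x) / l1 - (f x - esmooth l2 f x) / l2)) m0 _ _ _ _ => //.
- apply: continuous_subspaceT => y.
  by apply: cvgB; [exact: ce|exact: ce'].
- by move=> y _; apply: is_deriveB; exact: is_derive_esmooth.
- move=> y /andP[y0 ym].
  suff -> : l1 * ((f y - esmooth l1 f y) / l1 - (f y - esmooth l2 f y) / l2) +
    (esmooth l1 f y - esmooth l2 f y) = (1 - l1 / l2) * (f y - esmooth l2 f y).
    by rewrite mulr_ge0 // subr_ge0 ?ler_pdivrMr ?mul1r // le_f // ltW.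
  by field; rewrite !gt_eqF.
- by rewrite e0 // e0' // subrr.
Qed.

End Smoothing.

(** * The size-bias identity *)

Section SizeBias.
Context {R : realType} (I : finType).
Implicit Types (f g : R -> R) (x l : R) (c lam : I -> R).

Lemma is_derive_fsum (F : I -> R -> R) (d : I -> R) x :
  (forall k, is_derive x 1 (F k) (d k)) ->
  is_derive x 1 (fun y => \sum_k F k y) (\sum_k d k).
Proof.
move=> dF; rewrite (_ : (fun y => _) = \sum_k F k); last first.
  by apply/funext => y; rewrite fct_sumE.
by elim/big_ind2 : _ => // [|*]; [exact: is_derive_cst|exact: is_deriveD].
Qed.

Lemma continuous_fsum (V : topologicalType) (P : pred I) (F : I -> V -> R) (x : V) :
  (forall k, P k -> {for x, continuous (F k)}) ->
  {for x, continuous (fun y => \sum_(k | P k) F k y)}.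
Proof.
move=> cF; rewrite (_ : (fun y => _) = \sum_(k | P k) F k); last first.
  by apply/funext => y; rewrite fct_sumE.
elim/big_ind : _ => // [|f g cf cg]; first exact: cvg_cst.
exact: continuousD cf cg.
Qed.

Lemma causal_sum (F : I -> R -> R) :
  (forall k, causal (F k)) -> causal (fun y => \sum_k F k y).
Proof.
move=> cF; split=> x; last first.
  by move=> x0; rewrite big1 // => k _; case: (cF k) => _ ->.
by apply: continuous_fsum => k _; case: (cF k) => + _; apply.
Qed.

Lemma esmooth_sum l c (F : I -> R -> R) : 0 <= l -> (forall k, causal (F k)) ->
  esmooth l (fun x => \sum_k c k * F k x) = fun x => \sum_k c k * esmooth l (F k) x.
Proof.
rewrite le_eqVlt => /predU1P[<- _|l0 cF].
  rewrite esmooth0; apply/funext => x; apply: eq_bigr => k _; by rewrite esmooth0.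
apply/esym; apply: (@esmooth_uniq _ _ _ _
  (fun x => \sum_k (c k * ((F k x - esmooth l (F k) x) / l)))) => //.
- exact: ltW.
- by apply: causal_sum => k; exact: causalZ.
- by apply: causal_sum => k; apply: causalZ; apply: causal_esmooth => //; exact: ltW.
- move=> x x0; apply: is_derive_fsum => k; have ? := is_derive_esmooth x l0 (cF k).
  by apply: is_derive_eq; rewrite /GRing.scale /=; ring.
- move=> x x0; rewrite mulr_sumr -big_split /=; apply: eq_bigr => k _.
  by field; rewrite gt_eqF.
Qed.

Lemma prim_esmooth l f x : 0 <= l -> causal f ->
  prim f x = prim (esmooth l f) x + l * esmooth l f x.
Proof.
rewrite le_eqVlt => /predU1P[<-|l0 cf]; first by rewrite esmooth0 mul0r addr0.
have ce := causal_esmooth (ltW l0) cf.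
pose D y := prim f y - (prim (esmooth l f) y + l * esmooth l f y).
have dD (y : R) : is_derive y 1 (D : R -> R) (0 : R).
  have ? := is_derive_prim y cf; have ? := is_derive_prim y ce.
  have ? := is_derive_esmooth y l0 cf.
  apply: is_derive_eq; rewrite /GRing.scale /=; field; by rewrite gt_eqF.
have := @is_derive_0_is_cst _ D x 0 dD.
rewrite /D ((causal_prim cf).2 0) // ((causal_prim ce).2 0) // (ce.2 0) //.
rewrite mulr0 addr0 subr0 => /eqP.
by rewrite subr_eq0 => /eqP.
Qed.

(** If [f] is the distribution function of [Z], then [x * f x - prim f x] is the
    expectation of [Z] over the event [Z < x] (see [partial_mean]).  Adding an
    exponential of mean [l], itself a gamma variable of shape 1, adds one term
    to the sum. *)
Lemma size_bias_esmooth lam c f l : (forall k, 0 <= lam k) -> 0 <= l -> causal f ->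
  (forall x, x * f x - prim f x = \sum_k c k * esmooth (lam k) f x) ->
  forall x, x * esmooth l f x - prim (esmooth l f) x =
    \sum_k c k * esmooth (lam k) (esmooth l f) x + l * esmooth l (esmooth l f) x.
Proof.
move=> lam0 + cf H; rewrite le_eqVlt => /predU1P[<- x|l0 x].
  by rewrite esmooth0 mul0r addr0 H.
set g := esmooth l f; have cg : causal g := causal_esmooth (ltW l0) cf.
have cE : causal (esmooth l g) := causal_esmooth (ltW l0) cg.
have cP : causal (prim g) := causal_prim cg.
have cX (u : R -> R) : causal u -> causal (fun y => y * u y).
  move=> [cu u0]; split=> y; last by move=> /u0->; rewrite mulr0.
  by apply: cvgM; [exact: cvg_id|exact: cu].
pose A y := y * g y - prim g y - l * esmooth l g y.
have AE : A = esmooth l (fun y => y * f y - prim f y).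
  apply: (@esmooth_uniq _ _ _ _ (fun y => y * ((f y - g y) / l) - (g y - esmooth l g y))) => //.
  - exact: ltW.
  - by apply: causalB; [exact: cX|exact: causal_prim].
  - by apply: causalB; [apply: causalB => //; exact: cX|exact: causalZ].
  - move=> y y0; have ? : is_derive y 1 g _ := is_derive_esmooth y l0 cf.
    have ? := is_derive_esmooth y l0 cg; have ? := is_derive_prim y cg.
    apply: is_derive_eq; rewrite /GRing.scale /= -/g; field; by rewrite gt_eqF.
  - move=> y y0; rewrite /A (prim_esmooth y (ltW l0) cf) -/g; field; by rewrite gt_eqF.
have -> : x * g x - prim g x = A x + l * esmooth l g x by rewrite /A; ring.
congr (_ + _).
rewrite AE (_ : (fun y => _) = fun y => \sum_k c k * esmooth (lam k) f y); last exact/funext.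
rewrite esmooth_sum; [|exact: ltW|by move=> k; exact: causal_esmooth].
by apply: eq_bigr => k _; rewrite esmoothC // ltW.
Qed.

End SizeBias.

(** * Unimodality *)

Section Mode.
Context {R : realType} (I : finType) (a lam : I -> R) (h dh : R -> R).
Hypothesis a_gt0 : forall k, 0 < a k.
Hypothesis lam_ge0 : forall k, 0 <= lam k.
Hypothesis a_gt1 : 1 < \sum_(k | 0 < lam k) a k.
Hypothesis ch : causal h.
Hypothesis cdh : causal dh.
Hypothesis dhP : forall x : R, is_derive x 1 h (dh x).
Hypothesis h_gt0 : forall x, 0 < x -> 0 < h x.
Hypothesis hE : forall x, x * h x = \sum_k a k * lam k * esmooth (lam k) h x.

Let h0 : h 0 = 0. Proof. by case: ch => _ ->. Qed.
Let E k := esmooth (lam k) h.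

Let dE k (x : R) : is_derive x 1 (E k) (esmooth (lam k) dh x).
Proof. exact: is_derive_esmooth_comm. Qed.

(** Differentiate [hE], using that [l * (esmooth l h)' = h - esmooth l h]. *)
Lemma size_bias_derive x : h x + x * dh x = \sum_k a k * (h x - esmooth (lam k) h x).
Proof.
have d1 : is_derive x 1 (fun x => x * h x) (h x + x * dh x).
  by have ? := dhP x; apply: is_derive_eq; rewrite /GRing.scale /= mulr1 addrC.
have d2 : is_derive x 1 (fun x => x * h x) (\sum_k a k * (h x - E k x)).
  rewrite (_ : (fun x => _) = fun x => \sum_k a k * lam k * E k x); last exact/funext.
  apply: is_derive_fsum => k; have ? := dE k x.
  apply: is_derive_eq; rewrite /GRing.scale /= -/(E k).
  have := lam_ge0 k; rewrite le_eqVlt => /predU1P[l0|l0].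
    by rewrite /E -l0 !esmooth0; ring.
  suff -> : esmooth (lam k) dh x = (h x - E k x) / lam k by field; rewrite gt_eqF.
  have [_ <-] := dE k x; by have [_ <-] := is_derive_esmooth x l0 ch.
by have [_ <-] := d1; have [_ <-] := d2.
Qed.

Lemma h_cont_within (u v : R) : {within `[u, v], continuous h}.
Proof. by apply: continuous_subspaceT; case: ch. Qed.

Let incr_of_dh m : (forall x, 0 < x < m -> 0 <= dh x) ->
  forall x y, 0 <= x -> x <= y -> y <= m -> h x <= h y.
Proof.
move=> H x y x0 xy ym; apply: (@derive_ge0_le _ h dh) => //; first exact: h_cont_within.
by move=> z /andP[xz zy]; rewrite H // (le_lt_trans x0) //= (lt_le_trans zy).
Qed.

(** At a point where [h] attains a record, each smoothed value is at most [h x],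
    so [hE] bounds the point itself: [h] cannot keep increasing. *)
Lemma record_bound x : 0 < x -> (forall y, 0 < y < x -> h y <= h x) ->
  x <= \sum_k a k * lam k.
Proof.
move=> x0 H; rewrite -(ler_pM2r (h_gt0 x0)) hE mulr_suml; apply: ler_sum => k _.
rewrite ler_wpM2l ?mulr_ge0 //; first exact: ltW.
by apply: esmooth_le => //; [exact: ltW|exact/ltW/h_gt0].
Qed.

(** At a record [x], [h x - esmooth l h x >= expR (- (x / l)) * h x], because the
    part of the memory that reaches below 0 sees the value 0.  The weights
    [expR (- (x / lam k))] tend to 1 as [x] tends to 0, so [size_bias_derive] and
    [a_gt1] make [h x + x * dh x] larger than [h x]. *)
Lemma record_derive_gt0 : exists2 x0, 0 < x0 &
  forall x, 0 < x < x0 -> (forall y, 0 < y < x -> h y <= h x) -> 0 < dh x.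
Proof.
pose S x := \sum_(k | 0 < lam k) a k * expR (- (x / lam k)).
have cS : {for 0, continuous S}.
  apply: continuous_fsum => k _; apply: cvgM; first exact: cvg_cst.
  apply: continuous_comp; last exact: continuous_expR.
  by apply: continuousN; exact: mulrr_continuous.
have S0 : 1 < S 0.
  rewrite /S (eq_bigr a) // => k _; by rewrite mul0r oppr0 expR0 mulr1.
have /nbhs_ballP[e /= e0 Se] : \forall z \near 0, 1 < S z.
  by move/cvgr_gt : cS; apply.
exists e => // x /andP[x0 xe] H; have hx := h_gt0 x0.
have {}Se : 1 < S x by apply: Se; rewrite /ball /= sub0r normrN gtr0_norm.
have : h x < h x + x * dh x.
  rewrite size_bias_derive; apply: (@lt_le_trans _ _ (S x * h x)).
    by rewrite ltr_pMl.
  rewrite mulr_suml [leRHS](bigID (fun k => 0 < lam k)) /= -[leLHS]addr0 lerD //.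
    apply: ler_sum => k l0; rewrite -mulrA ler_pM2l //.
    have [cE E0] := causal_esmooth (ltW l0) ch.
    have : h x - E k 0 <= (h x - E k x) * expR (x / lam k).
      apply: (@relax_ge _ (lam k) (fun y => h x - E k y)
         (fun y => - ((h y - E k y) / lam k))) => //.
      - exact: ltW.
      - by apply: continuous_subspaceT => y; apply: cvgB; [exact: cvg_cst|exact: cE].
      - move=> y _; have ? : is_derive y 1 (E k) _ := is_derive_esmooth y l0 ch.
        by apply: is_derive_eq; rewrite -/(E k); ring.
      - move=> y yx; suff -> : lam k * - ((h y - E k y) / lam k) + (h x - E k y) = h x - h y.
          by rewrite subr_ge0 H.
        by field; rewrite gt_eqF.
    rewrite {1}/E E0 // subr0 => hE'.
    by rewrite expRN mulrC ler_pdivrMr ?expR_gt0.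
  apply: sumr_ge0 => k; rewrite -leNgt => l0.
  rewrite (_ : lam k = 0) ?esmooth0 ?subrr ?mulr0 //.
  by apply/eqP; rewrite eq_le l0 lam_ge0.
by rewrite ltrDl pmulr_rgt0.
Qed.

(** Near 0 every point is a record: otherwise the maximum of [h] before it would
    be an interior point, itself a record, with positive derivative. *)
Lemma derive_gt0_near0 : exists2 x0, 0 < x0 & forall x, 0 < x < x0 -> 0 < dh x.
Proof.
have [x0 x00 H] := record_derive_gt0; exists x0 => // x /andP[x_gt0 xx0].
apply: (H) => [|y /andP[y0 yx]]; first by rewrite x_gt0.
rewrite leNgt; apply/negP => hxy.
have [z] := EVT_max (ltW x_gt0) (@h_cont_within 0 x).
rewrite in_itv /= => /andP[z0 zx] zmax.
have hz : h x < h z by rewrite (lt_le_trans hxy) // zmax // in_itv /= !ltW.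
have {}zx : z < x by rewrite lt_neqAle zx andbT; apply: contraTneq hz => ->; rewrite ltxx.
have {}z0 : 0 < z.
  rewrite lt_neqAle z0 andbT; apply: contraTneq hz => <-.
  by rewrite h0 -leNgt ltW // h_gt0.
have : 0 < dh z.
  apply: (H) => [|t /andP[t0 tz]]; first by rewrite z0 (lt_trans zx).
  by rewrite zmax // in_itv /= !ltW // (lt_trans tz).
move=> /(derive_gt0_near (dhP z))[e e0 He].
pose t := z + Num.min e (x - z) / 2.
have mi : 0 < Num.min e (x - z) by rewrite lt_min e0 subr_gt0.
have [m1 m2] : Num.min e (x - z) <= e /\ Num.min e (x - z) <= x - z.
  by rewrite !ge_min !lexx orbT.
have : h z < h t by apply: (He t).1; rewrite /t; lra.
by rewrite ltNge zmax // in_itv /= /t; lra.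
Qed.

(** Let [m] be the first critical point.  The derivative of [x * dh x] at [m] is
    [- \sum_k a k * (esmooth (lam k) h)' m < 0], so [h] decreases just after [m].
    Were [dh] nonnegative at some [y > m], let [v] be a point where [h] is minimal
    on the interval from [m] to [y].  Seen backwards from [v], the values of [h]
    relative to [h v] are at least those seen from [m] relative to [h m]: hence
    each ratio [esmooth (lam k) h / h] with [0 < lam k] is larger at [v] than at [m],
    and [size_bias_derive] gives [dh v < 0], which contradicts the choice of [v]. *)
Lemma mode_exists : exists2 m, 0 < m &
  [/\ forall x, 0 < x < m -> 0 < dh x, dh m = 0 & forall x, m < x -> dh x < 0].
Proof.
have [x0 x0_gt0 H0] := derive_gt0_near0.
pose B := \sum_k a k * lam k.
pose Z : set R := [set x | 0 < x /\ dh x <= 0].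
have Z0 : Z !=set0.
  apply/set0P/negP => /eqP Z0.
  have pos x : 0 < x -> 0 < dh x.
    by move=> x_gt0; rewrite ltNge; apply/negP => dx; have : Z x; [|rewrite Z0].
  have B0 : 0 <= B by apply: sumr_ge0 => k _; rewrite mulr_ge0 // ltW.
  have := @record_bound (B + 1); rewrite -/B gerDl ler10 => /(_ _ _)/negP; apply => //.
    by rewrite ltr_wpDl.
  move=> y /andP[y0 yB]; apply: (@incr_of_dh (B + 1)) => //; try exact: ltW.
  by move=> x /andP[x_gt0 _]; exact/ltW/pos.
have lbZ : lbound Z x0.
  by move=> x [x_gt0 dx]; rewrite leNgt; apply/negP => xx0; move: dx; rewrite leNgt H0 // x_gt0.
have infZ : has_inf Z by split => //; exists x0.
pose m := inf Z; have m0 : 0 < m by rewrite (lt_le_trans x0_gt0) // lb_le_inf.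
have before x : 0 < x < m -> 0 < dh x.
  move=> /andP[x_gt0 xm]; rewrite ltNge; apply/negP => dx.
  by move: xm; rewrite ltNge ge_inf //; exists x0.
have cd : {for m, continuous dh} by case: cdh => + _; apply.
have dm : dh m = 0.
  apply/eqP; rewrite eq_le; apply/andP; split; rewrite leNgt; apply/negP => dm.
  - have /nbhs_ballP[e /= e0 He] : \forall z \near m, 0 < dh z.
      by move/cvgr_gt : cd; apply.
    have [z [z0 dz] zm] := @inf_adherent _ Z e e0 infZ.
    have mz : m <= z by apply: ge_inf => //; exists x0.
    have : 0 < dh z by apply: He; rewrite /ball /= distrC ger0_norm ?subr_ge0 // ltrBlDl.
    by rewrite ltNge dz.
  - have /nbhs_ballP[e /= e0 He] : \forall z \near m, dh z < 0.
      by move/cvgr_lt : cd; apply.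
    pose t := m - Num.min e m / 2.
    have [m1 m2] : Num.min e m <= e /\ Num.min e m <= m by rewrite !ge_min !lexx orbT.
    have mi : 0 < Num.min e m by rewrite lt_min e0.
    have : dh t < 0.
      by apply: He; rewrite /ball /= /t opprB addrC subrK gtr0_norm; lra.
    by rewrite ltNge ltW // before // /t; lra.
exists m => //; split=> // y my.
have Esm k : 0 < lam k -> 0 < esmooth (lam k) dh m.
  move=> l0; have [cE E0] := causal_esmooth (ltW l0) cdh.
  apply: (@relax_gt0_source _ (lam k) _ (fun y => (dh y - esmooth (lam k) dh y) / lam k)) => //.
  - by apply: continuous_subspaceT.
  - by move=> z _; exact: is_derive_esmooth.
  - move=> z zm; suff -> : lam k * ((dh z - esmooth (lam k) dh z) / lam k) +
      esmooth (lam k) dh z = dh z by exact: before.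
    by field; rewrite gt_eqF.
  - by rewrite E0.
have some_lam : exists k, 0 < lam k.
  apply/not_existsP => H; move: a_gt1; rewrite big1 ?ltr10 // => k /H //.
pose Y x := x * dh x.
have [e e0 He] : exists2 e, 0 < e & forall z, m < z < m + e -> dh z < 0.
  have dY : is_derive m 1 Y (- \sum_k a k * esmooth (lam k) dh m).
    rewrite (_ : Y = fun x => \sum_k a k * (h x - E k x) - h x); last first.
      by apply/funext => x; rewrite /Y /E -size_bias_derive; ring.
    rewrite (_ : - _ = \sum_k a k * (dh m - esmooth (lam k) dh m) - dh m).
      apply: is_deriveB; apply: is_derive_fsum => k; have ? := dE k m.
      by apply: is_derive_eq; rewrite /GRing.scale /=; ring.
    rewrite dm subr0 -sumrN; apply: eq_bigr => k _; ring.
  have [|e e0 He] := derive_lt0_near dY.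
    rewrite oppr_lt0; have [k0 k0P] := some_lam.
    apply: (@lt_le_trans _ _ (a k0 * esmooth (lam k0) dh m)); first by rewrite mulr_gt0 ?Esm.
    rewrite (bigD1 k0) //= lerDl sumr_ge0 // => k _; rewrite mulr_ge0 //; first exact: ltW.
    have := lam_ge0 k; rewrite le_eqVlt => /predU1P[<-|/Esm/ltW //].
    by rewrite esmooth0 dm.
  exists e => // z zm; have := (He z).1 zm; rewrite /Y dm mulr0 pmulr_rlt0 //.
  by case/andP: zm => + _; exact: lt_trans.
rewrite ltNge; apply/negP => dy.
have [v] := EVT_min (ltW my) (@h_cont_within m y).
rewrite in_itv /= => /andP[mv vy] vmin.
have hvm : h v < h m.
  pose t := m + Num.min e (y - m) / 2.
  have [m1 m2] : Num.min e (y - m) <= e /\ Num.min e (y - m) <= y - m.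
    by rewrite !ge_min !lexx orbT.
  have mi : 0 < Num.min e (y - m) by rewrite lt_min e0 subr_gt0.
  apply: (@le_lt_trans _ _ (h t)); first by apply: vmin; rewrite in_itv /= /t; lra.
  rewrite -ltrN2; apply: (@derive_gt0_lt _ (fun x => - h x) (fun x => - dh x)).
  - by rewrite /t; lra.
  - by apply: continuous_subspaceT => x; apply: cvgN; case: ch => + _; apply.
  - by move=> x /andP[mx xt]; rewrite oppr_gt0 He // mx /=; move: xt; rewrite /t; lra.
have {}mv : m < v by rewrite lt_neqAle mv andbT; apply: contraTneq hvm => ->; rewrite ltxx.
have v0 : 0 < v := lt_trans m0 mv.
have hm := h_gt0 m0; have hv := h_gt0 v0.
have incr := @incr_of_dh m (fun x xm => ltW (before x xm)).
have cmp k : 0 < lam k -> E k m * h v < E k v * h m.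
  move=> l0; have [cE E0] : causal (E k) := causal_esmooth (ltW l0) ch.
  (* Compare the history of [h] before [v], shifted by [v - m], with the one
     before [m]; both are normalized by the final value. *)
  pose w t := E k (t + (v - m)) * h m - E k t * h v.
  have Epos x : 0 < x -> 0 < E k x.
    move=> x_gt0; apply: (@relax_gt0_source _ (lam k) _ (fun y => (h y - E k y) / lam k)) => //.
    - by apply: continuous_subspaceT.
    - by move=> z _; exact: is_derive_esmooth.
    - move=> z /andP[z0 _]; suff -> : lam k * ((h z - E k z) / lam k) + E k z = h z by exact: h_gt0.
      by field; rewrite gt_eqF.
    - by rewrite E0.
  have dw (x : R) : is_derive x 1 w ((h (x + (v - m)) - E k (x + (v - m))) / lam k * h m
      - (h x - E k x) / lam k * h v).
    have ? : is_derive x 1 (E k) _ := is_derive_esmooth x l0 ch.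
    have d1 : is_derive (x + (v - m)) 1 (E k) _ := is_derive_esmooth (x + (v - m)) l0 ch.
    have d2 : is_derive x 1 (fun t => t + (v - m)) 1 by apply: is_derive_eq; rewrite addr0.
    have ? : is_derive x 1 (fun t => E k (t + (v - m))) _ := @is_derive1_comp _ (E k) _ x _ _ d1 d2.
    by apply: is_derive_eq; rewrite /GRing.scale /= -/(E k); ring.
  suff : 0 < w m by rewrite /w (addrC m) subrK subr_gt0.
  apply: (@relax_gt0 _ (lam k) _ _ m l0 (ltW m0) _ (fun x _ => dw x)).
  - by apply: continuous_subspaceT => x; exact: is_derive_continuous (dw x).
  - move=> t /andP[t0 tm].
    suff -> : lam k * ((h (t + (v - m)) - E k (t + (v - m))) / lam k * h m
      - (h t - E k t) / lam k * h v) + w t = h (t + (v - m)) * h m - h t * h v.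
      rewrite subr_ge0; have ht := h_gt0 t0.
      have [tv|tv] := leP (t + (v - m)) m.
      + have htv : h t <= h (t + (v - m)) by apply: incr => //; lra.
        by apply: ler_pM => //; exact: ltW.
      + have htm : h t <= h m by apply: incr => //; lra.
        have hvt : h v <= h (t + (v - m)) by apply: vmin; rewrite in_itv /=; lra.
        by rewrite mulrC; apply: ler_pM => //; exact: ltW.
    by rewrite /w; field; rewrite gt_eqF.
  - by rewrite /w (E0 0) // mul0r subr0 add0r mulr_gt0 // Epos // subr_gt0.
have dv : dh v < 0.
  have em := size_bias_derive m; have ev := size_bias_derive v.
  rewrite dm mulr0 addr0 in em.
  have : (h v + v * dh v) * h m < h m * h v.
    rewrite ev {2}em !mulr_suml; have [k0 k0P] := some_lam.
    have lek k : a k * (h v - E k v) * h m <= a k * (h m - E k m) * h v.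
      rewrite -!mulrA (ler_pM2l (a_gt0 k)).
      have := lam_ge0 k; rewrite le_eqVlt => /predU1P[l0|/cmp/ltW]; last first.
        by move=> le; rewrite !mulrBl (mulrC (h m)) lerD2l lerN2.
      by rewrite /E -l0 esmooth0 !subrr !mul0r.
    rewrite (bigD1 k0) //= [ltRHS](bigD1 k0) //=; apply: ltr_leD.
      rewrite -!mulrA ltr_pM2l // !mulrBl (mulrC (h m)) ltrD2l ltrN2; exact: cmp.
    by apply: ler_sum => k _; exact: lek.
  rewrite mulrDl (mulrC (h v)) gtrDl pmulr_llt0 // pmulr_rlt0 //.
have {}vy : v < y by rewrite lt_neqAle vy andbT; apply: contraTneq dv => ->; rewrite -leNgt.
have [e' e'0 He'] := derive_lt0_near (dhP v) dv.
pose t := v + Num.min e' (y - v) / 2.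
have [m1 m2] : Num.min e' (y - v) <= e' /\ Num.min e' (y - v) <= y - v.
  by rewrite !ge_min !lexx orbT.
have mi : 0 < Num.min e' (y - v) by rewrite lt_min e'0 subr_gt0.
have : h t < h v by apply: (He' t).1; rewrite /t; lra.
by rewrite ltNge vmin // in_itv /= /t; lra.
Qed.

End Mode.

(** * Two scales: the conditional share *)

Section TwoScale.
Context {R : realType} (p q a b : R) (h dh : R -> R).
Hypotheses (p_gt0 : 0 < p) (q_gt0 : 0 < q) (b_gt0 : 0 < b) (ab : b < a).
Hypothesis ch : causal h.
Hypothesis dhP : forall x : R, is_derive x 1 h (dh x).
Hypothesis h_gt0 : forall x, 0 < x -> 0 < h x.
Hypothesis hE : forall x, x * h x = p * a * esmooth a h x + q * b * esmooth b h x.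
Hypothesis dhE : forall x,
  h x + x * dh x = p * (h x - esmooth a h x) + q * (h x - esmooth b h x).

Let a_gt0 : 0 < a. Proof. exact: lt_trans ab. Qed.

(** If [h] is the density of [a * G + b * G'] for independent gamma variables of
    shapes [p] and [q], then [x * theta x] is the conditional mean of [a * G] given
    that the sum equals [x]. *)
Let theta x := p * a * esmooth a h x / (x * h x).
Let om := b^-1 - a^-1.
Let Q x t := p - (p + q) * t + om * x * t * (1 - t).

Let om_gt0 : 0 < om. Proof. by rewrite subr_gt0 ltf_pV2. Qed.

Let esmooth_ge0 l x : 0 < l -> 0 < x -> 0 <= esmooth l h x.
Proof.
move=> l0 x0; have [ce e0] := causal_esmooth (ltW l0) ch.
apply: (@relax_ge0 _ l _ (fun y => (h y - esmooth l h y) / l)) (ltW x0) _ _ _ _ => //.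
- exact: continuous_subspaceT.
- by move=> y _; exact: is_derive_esmooth.
- move=> y /andP[y0 _].
  suff -> : l * ((h y - esmooth l h y) / l) + esmooth l h y = h y by exact/ltW/h_gt0.
  by field; rewrite gt_eqF.
- by rewrite e0.
Qed.

Let theta_itv x : 0 < x -> 0 <= theta x <= 1.
Proof.
move=> x0; have hx : 0 < x * h x by rewrite mulr_gt0 ?h_gt0.
rewrite /theta ler_pdivlMr // ler_pdivrMr // mul0r mul1r hE.
by rewrite lerDl !mulr_ge0 ?esmooth_ge0 ?ltW.
Qed.

Let theta_derive (x : R) : 0 < x -> is_derive x 1 theta (Q x (theta x) / x).
Proof.
move=> x0; have hx := h_gt0 x0; have xh : x * h x != 0 by rewrite gt_eqF // mulr_gt0.
have d1 := is_derive_esmooth x a_gt0 ch; have d2 := dhP x.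
have d3 : is_derive x 1 (fun y => y * h y) (h x + x * dh x).
  by apply: is_derive_eq; rewrite /GRing.scale /= mulr1 addrC.
have d4 : is_derive x 1 (fun y => (y * h y)^-1) _ := @is_deriveV _ (fun y => y * h y) x _ _ xh d3.
have eb : esmooth b h x = (x * h x - p * a * esmooth a h x) / (q * b).
  by rewrite hE; field; rewrite !gt_eqF.
apply: is_derive_eq; rewrite /GRing.scale /= dhE eb /Q /theta /om.
by field; rewrite !gt_eqF.
Qed.

(** The share [theta] solves the Riccati equation [x * theta' = Q x theta], so the
    claim is that [theta] never decreases.  If [Q] were [- c < 0] at [x], then, going
    backwards from [x], [theta] stays above its value at [x] and [Q] stays below
    [- c]; thus [theta + c * ln] is nonincreasing up to [x], and [theta] would exceed
    1 close to 0. *)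
Lemma share_nondecreasing x : 0 < x -> 0 <= Q x (theta x).
Proof.
move=> x0_gt0; rewrite leNgt; apply/negP; set x0 := x in x0_gt0 *; set t0 := theta x0 => Q0.
have [t0_ge0 t0_le1] := andP (theta_itv x0_gt0).
pose c := - Q x0 t0; have c_gt0 : 0 < c by rewrite oppr_gt0.
have Qle y t : 0 < y -> y <= x0 -> t0 <= t -> t <= 1 -> Q y t <= - c.
  move=> y0 yx tt t1; rewrite /c opprK.
  have t_ge0 : 0 <= t := le_trans t0_ge0 tt.
  apply: (@le_trans _ _ (Q x0 t)).
    rewrite /Q lerD2l -!mulrA ler_pM2l // ler_wpM2r // mulr_ge0 // subr_ge0 //.
  have E : Q x0 t - Q x0 t0 = (t - t0) * (om * x0 * (1 - t - t0) - (p + q)).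
    by rewrite /Q; ring.
  rewrite -subr_le0 E mulr_ge0_le0 // ?subr_ge0 //.
  have [t00|t00] := eqVneq t0 0; first by move: Q0; rewrite /Q t00 !mulr0 mul0r addr0 subr0 ltNge ltW.
  have {}t00 : 0 < t0 by rewrite lt_neqAle eq_sym t00.
  rewrite -(pmulr_rle0 _ t00).
  have : t0 * (om * x0 * (1 - t - t0) - (p + q)) = Q x0 t0 - p - om * x0 * (t0 * t).
    by rewrite /Q; ring.
  move=> ->; have : 0 <= om * x0 * (t0 * t) by do 2?apply: mulr_ge0 => //; exact: ltW.
  by move: Q0 p_gt0; lra.
have ct y : 0 < y -> {for y, continuous theta}.
  by move=> y0; exact: is_derive_continuous (theta_derive y0).
have cw y : 0 < y -> {within `[y, x0], continuous theta}.
  move=> y0; apply: continuous_in_subspaceT => z.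
  by rewrite inE /= in_itv /= => /andP[yz _]; apply: ct; exact: lt_le_trans yz.
have back y : 0 < y -> y <= x0 -> t0 <= theta y.
  move=> y0 yx; rewrite leNgt; apply/negP => ty.
  have [z] := EVT_max yx (cw y y0); rewrite in_itv /= => /andP[yz zx] zmax.
  have tz : t0 <= theta z by apply: zmax; rewrite in_itv /= yx lexx.
  have {}yz : y < z.
    by rewrite lt_neqAle yz andbT; apply: contraTneq ty => ->; rewrite -leNgt.
  have z0 : 0 < z := lt_trans y0 yz.
  have [_ tz1] := andP (theta_itv z0).
  have dz : Q z (theta z) / z < 0.
    by rewrite pmulr_llt0 ?invr_gt0 // (le_lt_trans (Qle _ _ _ _ _ _)) // oppr_lt0.
  have [e e0 He] := derive_lt0_near (theta_derive z0) dz.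
  pose t := z - Num.min e (z - y) / 2.
  have [m1 m2] : Num.min e (z - y) <= e /\ Num.min e (z - y) <= z - y.
    by rewrite !ge_min !lexx orbT.
  have mi : 0 < Num.min e (z - y) by rewrite lt_min e0 subr_gt0.
  have : theta z < theta t by apply: (He t).2; rewrite /t; lra.
  by rewrite ltNge zmax // in_itv /= /t; lra.
(* At this point [c * ln] is smaller than at [x0] by 2, twice the range of [theta]. *)
pose x1 := x0 * expR (- (2 / c)).
have x1_gt0 : 0 < x1 by rewrite mulr_gt0 ?expR_gt0.
have x10 : x1 <= x0.
  by rewrite ler_piMr ?ltW // -expR0 ltr_expR oppr_lt0 divr_gt0.
have lnx1 : ln x1 = ln x0 - 2 / c by rewrite lnM ?posrE ?expR_gt0 // expRK.
have : - (theta x1 + c * ln x1) <= - (theta x0 + c * ln x0).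
  apply: (@derive_ge0_le _ (fun y => - (theta y + c * ln y))
    (fun y => - (Q y (theta y) / y + c * y^-1))) => //.
  - apply: continuous_in_subspaceT => z.
    rewrite inE /= in_itv /= => /andP[yz _]; have z0 := lt_le_trans x1_gt0 yz.
    apply: cvgN; apply: cvgD; first exact: ct.
    by apply: cvgM; [exact: cvg_cst|exact: continuous_ln].
  - move=> y /andP[xy _]; have y0 := lt_trans x1_gt0 xy.
    have ? := theta_derive y0; have ? := is_derive1_ln y0.
    by apply: is_derive_eq; rewrite /GRing.scale /=; ring.
  - move=> y /andP[xy yx]; have y0 := lt_trans x1_gt0 xy.
    have [_ ty1] := andP (theta_itv y0).
    have Qy : Q y (theta y) <= - c.
      by apply: Qle => //; [exact: ltW|apply: back => //; exact: ltW].
    by rewrite -mulrDl oppr_ge0 pmulr_lle0 ?invr_gt0 // -lerBrDr sub0r.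
rewrite lnx1 lerN2 => H.
have [_ tx1] := andP (theta_itv x1_gt0).
have cc : c * (ln x0 - 2 / c) = c * ln x0 - 2 by field; rewrite gt_eqF.
have aux (u v w : R) : 0 <= u -> u + w <= v + (w - 2) -> 2 <= v.
  by move=> *; lra.
rewrite cc in H; have := aux _ _ _ t0_ge0 H.
by rewrite leNgt (le_lt_trans tx1) // ltr1n.
Qed.

(** [share_nondecreasing] in terms of the two contributions to [x], with [theta]
    eliminated. *)
Lemma two_scale_ineq x X Y : 0 < x -> X = p * a * esmooth a h x / h x ->
  Y = q * b * esmooth b h x / h x ->
  0 <= p * Y - q * X + (b^-1 - a^-1) * X * Y.
Proof.
move=> x0 X_def Y_def; have hx := h_gt0 x0.
have X_E : X = x * theta x by rewrite X_def /theta; field; rewrite !gt_eqF.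
have Y_E : Y = x * (1 - theta x).
  rewrite mulrBr mulr1 -X_E X_def Y_def; apply/(mulIf (lt0r_neq0 hx)).
  by rewrite mulrBl !divfK ?gt_eqF // hE addrC addKr.
have -> : p * Y - q * X + (b^-1 - a^-1) * X * Y = x * Q x (theta x).
  by rewrite X_E Y_E /Q /om; ring.
by rewrite mulr_ge0 ?share_nondecreasing // ltW.
Qed.

End TwoScale.

(** * Bounds on the mode *)

Section ModeBounds.
Context {R : realType} (I : finType) (lam : I -> R) (alpha : R) (i j : I).
Context (h dh : R -> R).
Let a k := alpha + (k == i)%:R + (k == j)%:R.
Hypothesis alpha_gt0 : 0 < alpha.
Hypothesis neq_ij : i != j.
Hypothesis lam_ge0 : forall k, 0 <= lam k.
Hypothesis lam_sum : \sum_k lam k = 1.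
Hypothesis lam_j : 0 < lam j.
Hypothesis lam_ij : lam j < lam i.
Hypothesis ch : causal h.
Hypothesis cdh : causal dh.
Hypothesis dhP : forall x : R, is_derive x 1 h (dh x).
Hypothesis h_gt0 : forall x, 0 < x -> 0 < h x.
Hypothesis hE : forall x, x * h x = \sum_k a k * lam k * esmooth (lam k) h x.

Let a_gt0 k : 0 < a k.
Proof. by rewrite /a -addrA ltr_wpDr ?addr_ge0. Qed.

Let lam_i : 0 < lam i. Proof. exact: lt_trans lam_ij. Qed.

Let sum_a (f : I -> R) : \sum_k a k * f k = alpha * (\sum_k f k) + f i + f j.
Proof.
rewrite (eq_bigr (fun k => alpha * f k + ((k == i)%:R * f k + (k == j)%:R * f k))); last first.
  by move=> k _; rewrite /a; ring.
rewrite !big_split /= -mulr_sumr -addrA; congr (_ + (_ + _)).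
- by rewrite (bigD1 i) //= eqxx mul1r big1 ?addr0 // => k /negPf ->; rewrite mul0r.
- by rewrite (bigD1 j) //= eqxx mul1r big1 ?addr0 // => k /negPf ->; rewrite mul0r.
Qed.

Let a_gt1 : 1 < \sum_(k | 0 < lam k) a k.
Proof.
rewrite (bigD1 i) //=; apply: ltr_wpDr; first by apply: sumr_ge0 => k _; exact: ltW.
by rewrite /a eqxx -addrA addrC -addrA ltrDl ltr_wpDl.
Qed.

(** At the mode, [size_bias_derive] says that the [a k * psi k] sum to 1, and [hE]
    expresses [m] by the mean of [lam] for these weights.  Monotonicity of [psi] in
    the weight is [esmooth_anti], since [h] increases up to [m]. *)
Lemma mode_facts : exists2 m, 0 < m & exists psi : I -> R,
  [/\ (forall x, 0 < x < m -> 0 < dh x) /\ (forall x, m < x -> dh x < 0),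
      (forall k, esmooth (lam k) h m = (1 - psi k) * h m),
      \sum_k a k * psi k = 1,
      m = alpha + lam i + lam j - \sum_k a k * (psi k * lam k) &
      [/\ forall k, 0 <= psi k, forall k, 0 = lam k -> psi k = 0 &
       forall k k', lam k <= lam k' -> psi k <= psi k']].
Proof.
have [m m0 [d1 d2 d3]] := mode_exists a_gt0 lam_ge0 a_gt1 ch cdh dhP h_gt0 hE.
have hm := h_gt0 m0; have hm0 := lt0r_neq0 hm.
pose psi k := 1 - esmooth (lam k) h m / h m.
have psiE k : esmooth (lam k) h m = (1 - psi k) * h m.
  by rewrite /psi opprB addrC subrK divfK.
have incr x y : 0 <= x -> x <= y -> y <= m -> h x <= h y.
  move=> x0 xy ym; apply: (@derive_ge0_le _ h dh) => //.
    by apply: continuous_subspaceT; case: ch.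
  by move=> z /andP[xz zy]; rewrite ltW // d1 // (le_lt_trans x0) //= (lt_le_trans zy).
have psi_ge0 k : 0 <= psi k.
  rewrite /psi subr_ge0 ler_pdivrMr // mul1r; apply: esmooth_le => //; try exact: ltW.
  by move=> x /andP[x0 xm]; apply: incr => //; exact: ltW.
have psi0 k : 0 = lam k -> psi k = 0.
  by move=> l0; rewrite /psi -l0 esmooth0 divff ?subrr.
have psi_le k k' : lam k <= lam k' -> psi k <= psi k'.
  move=> kk'; rewrite /psi lerD2l lerN2 ler_pM2r ?invr_gt0 //.
  by apply: esmooth_anti => //; exact: ltW.
move: psi psiE psi_ge0 psi0 psi_le => psi psiE psi_ge0 psi0 psi_le.
have E1 : \sum_k a k * psi k = 1.
  apply/(mulIf hm0); rewrite mul1r.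
  have := size_bias_derive lam_ge0 ch cdh dhP hE m; rewrite d2 mulr0 addr0 => {2}->.
  by rewrite mulr_suml; apply: eq_bigr => k _; rewrite psiE; ring.
have mE : m = alpha + lam i + lam j - \sum_k a k * (psi k * lam k).
  apply/(mulIf hm0); rewrite hE.
  have -> : alpha + lam i + lam j = \sum_k a k * lam k by rewrite sum_a lam_sum mulr1.
  by rewrite -sumrB mulr_suml; apply: eq_bigr => k _; rewrite psiE; ring.
by exists m; [exact: m0|exists psi; split; [split|..|split]].
Qed.

(** A mean of weights is at most [lam i + lam j] if each of them is. *)
Lemma density_increasing x : (forall k, lam k <= lam i + lam j) ->
  0 < x -> x < alpha -> 0 < dh x.
Proof.
move=> lam_s x0 xa; have [m m0 [psi [[d1 _] _ E1 mE [psi_ge0 _ _]]]] := mode_facts.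
apply: d1; rewrite x0 /= (lt_le_trans xa) // mE -addrA -addrA lerDl addrA subr_ge0.
rewrite -[leRHS]mul1r -E1 mulr_suml; apply: ler_sum => k _.
by rewrite mulrA ler_wpM2l // mulr_ge0 // ltW.
Qed.

Let sum_ij : lam i + lam j <= 1.
Proof.
rewrite -lam_sum (bigD1 i) //= lerD2l (bigD1 j) 1?eq_sym //= lerDl.
by apply: sumr_ge0.
Qed.

(** Here the mean must be at least [lam i + lam j - 1 / 2].  Off the pair this holds
    termwise.  For [i] and [j] the two deviations have the nonnegative sum
    [1 - (lam i + lam j)], and [psi] gives the favourable one the larger factor. *)
Lemma density_decreasing x :
  (forall k, k != i -> k != j -> 0 < lam k -> lam i + lam j <= lam k + 1 / 2) ->
  alpha + 1 / 2 < x -> dh x < 0.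
Proof.
move=> lam_s xa; have [m m0 [psi [[_ d3] _ E1 mE [psi_ge0 psi0 psiM]]]] := mode_facts.
apply: d3; apply: le_lt_trans xa.
have -> : alpha + 1 / 2 = m + \sum_k a k * (psi k * (lam k + 1 / 2 - (lam i + lam j))).
  rewrite (eq_bigr (fun k => a k * (psi k * lam k) +
    (1 / 2 - (lam i + lam j)) * (a k * psi k))); last by move=> k _; ring.
  by rewrite big_split /= -mulr_sumr E1 {1}mE; ring.
rewrite lerDl sum_a.
have -> : \sum_k psi k * (lam k + 1 / 2 - (lam i + lam j)) =
  psi i * (1 / 2 - lam j) + (psi j * (1 / 2 - lam i) +
  \sum_(k | (k != i) && (k != j)) psi k * (lam k + 1 / 2 - (lam i + lam j))).
  rewrite (bigD1 i) //= (bigD1 j) 1?eq_sym //=; congr (_ + (_ + _)); ring.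
have S0 : 0 <= \sum_(k | (k != i) && (k != j)) psi k * (lam k + 1 / 2 - (lam i + lam j)).
  apply: sumr_ge0 => k /andP[ki kj].
  have := lam_ge0 k; rewrite le_eqVlt => /predU1P[l0|l0].
    by rewrite psi0 // mul0r.
  by rewrite mulr_ge0 // subr_ge0 lam_s.
have P0 : 0 <= psi i * (1 / 2 - lam j) + psi j * (1 / 2 - lam i).
  have pij : psi j <= psi i by apply: psiM; exact: ltW.
  have lj : 0 <= 1 / 2 - lam j by move: lam_ij sum_ij => *; lra.
  have -> : psi i * (1 / 2 - lam j) + psi j * (1 / 2 - lam i) =
    (psi i - psi j) * (1 / 2 - lam j) + psi j * (1 - (lam i + lam j)) by field.
  by rewrite addr_ge0 // mulr_ge0 // subr_ge0.
set S := \sum_(k | _) _ in S0 *.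
have -> : alpha * (psi i * (1 / 2 - lam j) + (psi j * (1 / 2 - lam i) + S)) +
  psi i * (lam i + 1 / 2 - (lam i + lam j)) + psi j * (lam j + 1 / 2 - (lam i + lam j))
  = (alpha + 1) * (psi i * (1 / 2 - lam j) + psi j * (1 / 2 - lam i)) + alpha * S by ring.
by rewrite addr_ge0 // mulr_ge0 // ?addr_ge0 // ltW.
Qed.

(** The weights take only two values, so [h] is the density of a sum of two gamma
    variables, of shapes [p] and [q].  With [d = p * psi i] the mode is
    [alpha + lam i - (lam i - lam j) * d], and [two_scale_ineq] at the mode is a
    quadratic inequality in [d] that fails when the mode exceeds [alpha + 1 / 2]. *)
Lemma density_decreasing_one_large x : (forall k, k != i -> lam k = lam j) ->
  (2 < #|I|)%N -> 1 / 2 < lam i -> alpha + 1 / 2 < x -> dh x < 0.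
Proof.
move=> lam_k card_I lam_half xa; have [m m0 [psi [[_ d3] psiE E1 mE _]]] := mode_facts.
apply: d3; apply: le_lt_trans xa; rewrite leNgt; apply/negP => am.
have hm := h_gt0 m0.
pose N : R := (#|I|.-1)%:R; pose p := alpha + 1; pose q := N * alpha + 1.
have N2 : 2 <= N by rewrite ler_nat; case: #|I| card_I.
have card1 : #|predC1 i| = #|I|.-1 by rewrite cardC1.
have sum_k (f : I -> R) c : (forall k, k != i -> f k = c) -> \sum_k f k = f i + N * c.
  move=> fc; rewrite (bigD1 i) //=; congr (_ + _).
  by rewrite (eq_bigr (fun=> c)) // sumr_const card1 mulr_natl.
have lN : lam i + N * lam j = 1 by rewrite -(sum_k lam _ lam_k).
have sum_pq (f : I -> R) : (forall k, k != i -> f k = f j) ->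
    \sum_k a k * f k = p * f i + q * f j.
  by move=> fj; rewrite sum_a (sum_k _ _ fj) /p /q; ring.
have hE' y : y * h y = p * lam i * esmooth (lam i) h y + q * lam j * esmooth (lam j) h y.
  rewrite hE -!mulrA -(sum_pq (fun k => lam k * esmooth (lam k) h y)).
    by apply: eq_bigr => k _; rewrite mulrA.
  by move=> k /lam_k->.
have dhE' y : h y + y * dh y = p * (h y - esmooth (lam i) h y) + q * (h y - esmooth (lam j) h y).
  rewrite (size_bias_derive lam_ge0 ch cdh dhP hE).
  rewrite -(sum_pq (fun k => h y - esmooth (lam k) h y)) //.
  by move=> k /lam_k->.
have p0 : 0 < p by rewrite addr_gt0.
have q0 : 0 < q by rewrite addr_gt0 // mulr_gt0 // (lt_le_trans _ N2).
have := two_scale_ineq p0 q0 lam_j lam_ij ch dhP h_gt0 hE' dhE' m0 erefl erefl.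
pose d := p * psi i.
have psi_k k : k != i -> psi k = psi j.
  move=> /lam_k lk; have := psiE k; rewrite lk psiE => /(mulIf (lt0r_neq0 hm)).
  by move=> /addrI/oppr_inj.
have qd : q * psi j = 1 - d by rewrite -E1 (sum_pq psi psi_k) /d; ring.
have -> : p * lam i * esmooth (lam i) h m / h m = lam i * (p - d).
  by rewrite psiE /d; field; rewrite gt_eqF.
have -> : q * lam j * esmooth (lam j) h m / h m = lam j * (q - (1 - d)).
  by rewrite -qd psiE; field; rewrite gt_eqF.
have {}mE : m = alpha + lam i - (lam i - lam j) * d.
  rewrite mE (sum_pq (fun k => psi k * lam k)); last first.
    by move=> k ki; rewrite psi_k // lam_k.
  have qd' : q * (psi j * lam j) = (1 - d) * lam j by rewrite mulrA qd.
  by rewrite qd' mulrA -/d; ring.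
have -> : p * (lam j * (q - (1 - d))) - q * (lam i * (p - d)) +
   ((lam j)^-1 - (lam i)^-1) * (lam i * (p - d)) * (lam j * (q - (1 - d))) =
   (alpha + 2 * lam i) * d - (lam i - lam j) * d ^+ 2 - lam i * (alpha + 1)
   + alpha * d * (lam i + N * lam j - 1).
  by rewrite /p /q; field; rewrite !gt_eqF.
rewrite lN subrr mulr0 addr0 => ineq.
set A := lam i in lam_half mE ineq lN *; set B := lam j in mE ineq lN *.
have A1 : A <= 1 by rewrite -lN lerDl mulr_ge0 ?ltW // (lt_le_trans _ N2).
have B2 : 2 * B <= 1 - A.
  have : 2 * B <= N * B by rewrite ler_pM2r.
  by move: lN; lra.
have AB : 0 < A - B by rewrite subr_gt0.
have u_lt : (A - B) * d < A - 1 / 2 by rewrite mE in am; move: am; lra.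
set u := (A - B) * d in u_lt.
have : 0 <= (alpha + 2 * A) * u - u ^+ 2 - A * (alpha + 1) * (A - B).
  have -> : (alpha + 2 * A) * u - u ^+ 2 - A * (alpha + 1) * (A - B) =
    (A - B) * ((alpha + 2 * A) * d - (A - B) * d ^+ 2 - A * (alpha + 1)) by rewrite /u; ring.
  by rewrite mulr_ge0 // ltW.
have -> : (alpha + 2 * A) * u - u ^+ 2 - A * (alpha + 1) * (A - B) =
  - ((A - 1 / 2 - u) * (alpha + A + 1 / 2 - u) + alpha * ((A - 1 / 2) ^+ 2 + 1 / 4 - A * B)
     + (1 / 4 - A * B)) by field.
have AB4 : A * B <= 1 / 8.
  have : A * (2 * B) <= A * (1 - A) by rewrite ler_wpM2l // ltW.
  have : 0 <= (A - 1 / 2) ^+ 2 by exact: sqr_ge0.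
  by rewrite expr2; lra.
rewrite oppr_ge0 leNgt => /negP; apply; apply: ltr_wpDl; last by lra.
apply: addr_ge0.
  by apply: mulr_ge0; move: alpha_gt0 AB A1 u_lt; lra.
apply: mulr_ge0; first exact: ltW.
have : 0 <= (A - 1 / 2) ^+ 2 by exact: sqr_ge0.
by move: AB4; lra.
Qed.

End ModeBounds.

(** * The density governing a pair of weights *)

Section PairDensity.
Context {R : realType} (I : finType) (lam : I -> R) (alpha : R) (i j : I) (F : R -> R).
Hypothesis alpha_gt0 : 0 < alpha.
Hypothesis neq_ij : i != j.
Hypothesis lam_ge0 : forall k, 0 <= lam k.
Hypothesis lam_j : 0 < lam j.
Hypothesis lam_ij : lam j < lam i.
Hypothesis cF : causal F.
Hypothesis F_ndecr : forall x y, x <= y -> F x <= F y.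
Hypothesis F_gt0 : forall x, 0 < x -> 0 < F x.
Hypothesis FE : forall x,
  x * F x - prim F x = \sum_k alpha * lam k * esmooth (lam k) F x.

Let lam_i : 0 < lam i. Proof. exact: lt_trans lam_ij. Qed.
Let ij_gt0 : 0 < lam i - lam j. Proof. by rewrite subr_gt0. Qed.

(** The density of [S + lam i * E + lam j * E'] when [F] is the distribution
    function of [S]: the derivative of [esmooth (lam i) (esmooth (lam j) F)], in
    partial fractions. *)
Definition pair_density x := (esmooth (lam j) F x - esmooth (lam i) F x) / (lam i - lam j).

Definition pair_slope x :=
  ((F x - esmooth (lam j) F x) / lam j - (F x - esmooth (lam i) F x) / lam i)
  / (lam i - lam j).

Let cEi : causal (esmooth (lam i) F). Proof. exact: causal_esmooth (ltW _) _. Qed.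
Let cEj : causal (esmooth (lam j) F). Proof. exact: causal_esmooth (ltW _) _. Qed.

Lemma causal_pair_density : causal pair_density.
Proof.
rewrite (_ : pair_density = fun x => (lam i - lam j)^-1 *
  (esmooth (lam j) F x - esmooth (lam i) F x)).
  by apply: causalZ; exact: causalB.
by apply/funext => x; rewrite mulrC.
Qed.

Lemma causal_pair_slope : causal pair_slope.
Proof.
rewrite (_ : pair_slope = fun x => (lam i - lam j)^-1 *
  ((lam j)^-1 * (F x - esmooth (lam j) F x) - (lam i)^-1 * (F x - esmooth (lam i) F x))).
  by apply: causalZ; apply: causalB; apply: causalZ; exact: causalB.
by apply/funext => x; rewrite /pair_slope; ring.
Qed.

Lemma is_derive_pair_density (x : R) : is_derive x 1 pair_density (pair_slope x).
Proof.
have ? := is_derive_esmooth x lam_i cF; have ? := is_derive_esmooth x lam_j cF.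
by rewrite /pair_density; apply: is_derive_eq; rewrite /pair_slope /GRing.scale /=; ring.
Qed.

(** [esmooth (lam j) F - esmooth (lam i) F] satisfies a first-order equation with
    memory [lam j] whose source is a positive multiple of [F - esmooth (lam i) F]. *)
Lemma pair_density_gt0 x : 0 < x -> 0 < pair_density x.
Proof.
move=> x0; rewrite /pair_density divr_gt0 //.
apply: (@relax_gt0_source _ (lam j) (fun y => esmooth (lam j) F y - esmooth (lam i) F y)
  (fun y => (F y - esmooth (lam j) F y) / lam j - (F y - esmooth (lam i) F y) / lam i)) => //.
- apply: continuous_subspaceT => y.
  by apply: cvgB; [case: cEj => + _; apply|case: cEi => + _; apply].
- by move=> y _; apply: is_deriveB; exact: is_derive_esmooth.
- move=> y /andP[y0 yx].
  suff -> : lam j * ((F y - esmooth (lam j) F y) / lam j - (F y - esmooth (lam i) F y) / lam i)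
    + (esmooth (lam j) F y - esmooth (lam i) F y) =
    (lam i - lam j) / lam i * (F y - esmooth (lam i) F y).
    rewrite mulr_gt0 ?divr_gt0 // subr_gt0; apply: esmooth_lt => //; first exact: ltW.
    exact: F_gt0.
    by move=> z /andP[_ zy]; apply: F_ndecr; exact: ltW.
  by field; rewrite !gt_eqF.
- by rewrite (cEi.2 0) // (cEj.2 0) // subrr.
Qed.

Let K := esmooth (lam i) (esmooth (lam j) F).

Let K_E : K = esmooth (lam j) (esmooth (lam i) F).
Proof. by apply: esmoothC => //; exact: ltW. Qed.

Let dK (x : R) : is_derive x 1 K (pair_density x).
Proof.
have d1 := is_derive_esmooth x lam_i cEj; rewrite -/K in d1.
have d2 := is_derive_esmooth x lam_j cEi; rewrite -K_E in d2.
have E : (esmooth (lam j) F x - K x) / lam i = (esmooth (lam i) F x - K x) / lam j.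
  by have [_ <-] := d1; have [_ <-] := d2.
suff -> : pair_density x = (esmooth (lam j) F x - K x) / lam i by [].
set k := (_ / lam i) in E *; rewrite /pair_density.
have -> : esmooth (lam j) F x = K x + lam i * k by rewrite /k; field; rewrite gt_eqF.
have -> : esmooth (lam i) F x = K x + lam j * k by rewrite E; field; rewrite gt_eqF.
by field; rewrite gt_eqF.
Qed.

(** The two exponentials raise the coefficients of [i] and [j] by 1, by
    [size_bias_esmooth]; passing to densities removes the [prim] term. *)
Lemma pair_density_size_bias x : x * pair_density x = \sum_k
  (alpha + (k == i)%:R + (k == j)%:R) * lam k * esmooth (lam k) pair_density x.
Proof.
have cK : causal K := causal_esmooth (ltW lam_i) cEj.
have pick l (f : I -> R) : lam l * f l = \sum_k (k == l)%:R * lam k * f k.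
  by rewrite (bigD1 l) //= eqxx mul1r big1 ?addr0 // => k /negPf ->; rewrite !mul0r.
have H1 y : y * esmooth (lam j) F y - prim (esmooth (lam j) F) y =
    \sum_k (alpha * lam k + (k == j)%:R * lam k) * esmooth (lam k) (esmooth (lam j) F) y.
  rewrite (size_bias_esmooth lam_ge0 (ltW lam_j) cF FE).
  rewrite (pick j (fun k => esmooth (lam k) (esmooth (lam j) F) y)) -big_split /=.
  by apply: eq_bigr => k _; rewrite -mulrDl.
have H2 y : y * K y - prim K y =
    \sum_k (alpha + (k == i)%:R + (k == j)%:R) * lam k * esmooth (lam k) K y.
  rewrite (size_bias_esmooth lam_ge0 (ltW lam_i) cEj H1).
  rewrite (pick i (fun k => esmooth (lam k) K y)) -big_split /=.
  by apply: eq_bigr => k _; rewrite -/K; ring.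
have d1 : is_derive x 1 (fun y => y * K y - prim K y) (x * pair_density x).
  have ? := dK x; have ? := is_derive_prim x cK.
  by apply: is_derive_eq; rewrite /GRing.scale /=; ring.
have d2 : is_derive x 1 (fun y => y * K y - prim K y) (\sum_k
    ((alpha + (k == i)%:R + (k == j)%:R) * lam k * esmooth (lam k) pair_density x)).
  rewrite (_ : (fun y => _) = fun y => \sum_k
    (alpha + (k == i)%:R + (k == j)%:R) * lam k * esmooth (lam k) K y); last exact/funext.
  apply: is_derive_fsum => k.
  have ? := is_derive_esmooth_comm x (lam_ge0 k) cK causal_pair_density dK.
  by apply: is_derive_eq; rewrite /GRing.scale /=; ring.
by have [_ <-] := d1; have [_ <-] := d2.
Qed.

End PairDensity.

(** * The gamma distribution function *)

Section GammaCdf.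
Context {R : realType} (alpha C : R) (Phi : R -> R).
Hypothesis alpha_gt0 : 0 < alpha.
Hypothesis cPhi : causal Phi.
Hypothesis dPhi : forall t : R, 0 < t ->
  is_derive t 1 Phi (C * t `^ (alpha - 1) * expR (- t)).

Let f t : R := C * t `^ (alpha - 1) * expR (- t).
Let H t := t * Phi t - prim Phi t.

Let causal_tPhi : causal (fun t => t * Phi t).
Proof.
split=> t; last by move=> t0; rewrite cPhi.2 // mulr0.
by apply: cvgM; [exact: cvg_id|exact: cPhi.1].
Qed.

Let causal_H : causal H.
Proof. by apply: causalB; [exact: causal_tPhi|exact: causal_prim]. Qed.

Let dH (t : R) : 0 < t -> is_derive t 1 H (t * f t).
Proof.
move=> t0; have ? := dPhi t0; have ? := is_derive_prim t cPhi.
by apply: is_derive_eq; rewrite /GRing.scale /= /f; ring.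
Qed.

Let tf_cvg0 : t * f t @[t --> 0^'+] --> (0 : R).
Proof.
have L0 : C * 0 * expR (- 0) = 0 :> R by rewrite mulr0 mul0r.
rewrite -[X in _ --> X]L0; have : C * t `^ alpha * expR (- t) @[t --> 0^'+] --> C * 0 * expR (- 0).
  apply: cvgM; first by apply: cvgM; [exact: cvg_cst|exact: powR_cvg0].
  apply: cvg_at_right_filter; apply: continuous_comp; last exact: continuous_expR.
  exact: opp_continuous.
have E : {near 0^'+, (fun t : R => C * t `^ alpha * expR (- t)) =1 (fun t => t * f t)}.
  near=> t; have t0 : 0 < t by near: t; exact: nbhs_right_gt.
  by rewrite /f -(mulr_powRB1 (ltW t0) alpha_gt0); ring.
exact: (cvg_trans (near_eq_cvg E)).
Unshelve. all: by end_near. Qed.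

(** Both sides have the derivative [t * f t] and tend to 0 at 0. *)
Let HE t : 0 < t -> H t = alpha * Phi t - t * f t.
Proof.
pose W t := H t + t * f t - alpha * Phi t.
have dW (s : R) : 0 < s -> is_derive s 1 W 0.
  move=> s0; have ? := dH s0; have ? := dPhi s0; have ? := is_derive1_powR (alpha - 1) s0.
  have dE : is_derive s 1 (fun x : R => expR (- x)) (- expR (- s)).
    have dN : is_derive s 1 (fun x : R => - x) (- 1) by apply: is_derive_eq.
    by have := @is_derive1_comp _ expR (fun x => - x) s _ _ (is_derive_expR _) dN;
      rewrite mulrN1.
  rewrite /W /f; apply: is_derive_eq; rewrite /GRing.scale /=.
  have -> : s `^ (alpha - 1 - 1) = s `^ (alpha - 1) / s.
    by rewrite -[in RHS](powR_inv1 (ltW s0)) -powRD // (gt_eqF s0) implybT.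
  by rewrite /f; field; rewrite gt_eqF.
have Wcst (v u : R) : 0 < v -> v < u -> W u = W v.
  move=> s0 su; have dW' x : x \in `]v, u[ -> is_derive x 1 W 0.
    by rewrite in_itv /= => /andP[sx _]; apply: dW; exact: lt_trans sx.
  have [|c _] := @MVT _ W (fun=> 0) v u su dW'.
    apply: continuous_in_subspaceT => x; rewrite inE /= in_itv /= => /andP[sx _].
    exact: is_derive_continuous (dW x (lt_le_trans s0 sx)).
  by rewrite mul0r => /eqP; rewrite subr_eq0 => /eqP.
move=> t0; apply/eqP; rewrite -subr_eq0; apply/eqP.
have -> : H t - (alpha * Phi t - t * f t) = W t by rewrite /W; ring.
have W0 : W x @[x --> 0^'+] --> (0 : R).
  have L0 : H 0 + 0 - alpha * Phi 0 = 0.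
    by rewrite causal_H.2 // cPhi.2 // mulr0 addr0 subr0.
  rewrite -[X in _ --> X]L0; apply: cvgB.
    apply: cvgD; last exact: tf_cvg0.
    by apply: cvg_at_right_filter; exact: causal_H.1.
  apply: cvgM; first exact: cvg_cst.
  by apply: cvg_at_right_filter; exact: cPhi.1.
have Wt : W x @[x --> 0^'+] --> W t.
  apply: cvg_near_cst; near=> s; apply/esym/Wcst; first by near: s; exact: nbhs_right_gt.
  by near: s; exact: nbhs_right_lt.
exact: cvg_unique Wt W0.
Unshelve. all: by end_near. Qed.

(** The size bias of the gamma law: its partial mean is [alpha] times the
    distribution function of the variable plus an independent standard
    exponential.  With [H] for the left-hand side, [H + H' = alpha * Phi]. *)
Lemma gamma_partial_mean t : t * Phi t - prim Phi t = alpha * esmooth 1 Phi t.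
Proof.
have cH := causalZ alpha^-1 causal_H.
have <- : (fun t => alpha^-1 * H t) = esmooth 1 Phi.
  apply: (@esmooth_uniq _ _ _ _ (fun t => alpha^-1 * (t * f t))) => // x x0.
    by have ? := dH x0; apply: is_derive_eq; rewrite /GRing.scale /=; ring.
  by rewrite HE //; field; rewrite gt_eqF.
by rewrite mulrA divff ?mul1r // gt_eqF.
Qed.

Lemma gamma_density_gap t : 0 < t -> t * f t = alpha * (Phi t - esmooth 1 Phi t).
Proof.
by move=> t0; rewrite mulrBr -gamma_partial_mean -/(H t) HE //; ring.
Qed.

End GammaCdf.

(** * Independence and mixing *)

Lemma mem_boolset (T : Type) (b : T -> bool) w : (w \in [set w | b w]) = b w.
Proof. by apply/idP/idP; rewrite inE. Qed.

Section JointLaw.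
Context d (T : measurableType d) (R : realType) (P : probability T R).
Implicit Types (U V : {mfun T >-> R}).

Lemma measurable_pair U V : measurable_fun setT (fun w => (U w, V w)).
Proof. exact: measurable_fun_pair. Qed.

(** The extra event [E] stands for constraints on further variables; keeping it
    makes the induction of [independent_lincomb] go through. *)
Lemma joint_law_cond U V (E : set T) : measurable E ->
  (forall A B, measurable A -> measurable B ->
    P (U @^-1` A `&` V @^-1` B `&` E) = (P (U @^-1` A) * P (V @^-1` B) * P E)%E) ->
  forall D, measurable D -> P ((fun w => (U w, V w)) @^-1` D `&` E) =
    ((distribution P U \x distribution P V)%E D * P E)%E.
Proof.
move=> mE H D mD.
have PE : P E \is a fin_num by exact: fin_num_measure.
have [E0|E0] := eqVneq (P E) 0%E.
  rewrite E0 mule0; apply/eqP; rewrite eq_le measure_ge0 andbT -E0.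
  rewrite le_measure ?inE //; apply: measurableI => //.
  by rewrite -[X in measurable X]setTI; exact: measurable_pair.
pose e := fine (P E); have e0 : 0 < e.
  by rewrite fine_gt0 // ltey_eq PE /= lt0e E0 measure_ge0.
have eE : P E = e%:E by rewrite /e fineK.
have ei0 : 0 <= e^-1 by rewrite invr_ge0 ltW.
have [m' m'E] : exists m' : {measure set (R * R) -> \bar R},
    forall D, m' D = (e^-1%:E * P ((fun w => (U w, V w)) @^-1` D `&` E))%E.
  unshelve eexists (mscale (NngNum ei0)
    (pushforward (mrestr P mE) (fun w => (U w, V w)) : {measure set (R * R) -> \bar R})).
  - exact: measurable_pair.
  - by [].
rewrite (@product_measure_unique _ _ _ _ _ (distribution P U) (distribution P V) m') //.
  by rewrite m'E eE muleAC -EFinM mulVf ?mul1e // gt_eqF.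
move=> A B mA mB; rewrite m'E.
have -> : (fun w => (U w, V w)) @^-1` (A `*` B) = U @^-1` A `&` V @^-1` B by [].
by rewrite H // eE muleCA -muleA -EFinM mulVf ?mule1 // gt_eqF.
Qed.

Definition independent2 U V := forall A B, measurable A -> measurable B ->
  P (U @^-1` A `&` V @^-1` B) = (P (U @^-1` A) * P (V @^-1` B))%E.

Lemma joint_law U V : independent2 U V -> forall D, measurable D ->
  P ((fun w => (U w, V w)) @^-1` D) = (distribution P U \x distribution P V)%E D.
Proof.
move=> UV D mD; have := @joint_law_cond U V setT measurableT _ D mD.
rewrite setIT probability_setT mule1; apply => A B mA mB.
by rewrite setIT mule1 UV.
Qed.

Lemma joint_integral U V (g : R * R -> \bar R) : independent2 U V ->
  measurable_fun setT g -> (forall z, (0 <= g z)%E) ->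
  (\int[P]_w g (U w, V w) = \int[P]_w' \int[P]_w g (U w, V w'))%E.
Proof.
move=> UV mg g0.
have -> : (\int[P]_w g (U w, V w) =
   \int[(distribution P U \x distribution P V)%E]_z g z)%E.
  have mUV := measurable_pair U V.
  rewrite -(@ge0_integral_pushforward _ _ _ _ _ _ mUV P setT g) //.
  by apply: eq_measure_integral => D mD _; exact: joint_law.
rewrite (@fubini_tonelli2 _ _ _ _ _ (distribution P U) (distribution P V)) //.
rewrite /fubini_G ge0_integral_distribution //=.
- apply: eq_integral => w _ /=; rewrite ge0_integral_distribution //.
  exact: measurableT_comp.
- exact: measurable_fun_fubini_tonelli_G.
- by move=> y; exact: integral_ge0.
Qed.

(** Integrate over [U] first, with [V] frozen. *)
Lemma mixing_integral U V (v : R -> R) (l x : R) : independent2 U V -> 0 < l ->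
  measurable_fun setT v -> (forall y, 0 <= v y) ->
  (\int[P]_(w in [set w | (l * U w + V w < x)%R]) (v (U w))%:E =
   \int[P]_w' \int[P]_(w in [set w | (U w < (x - V w') / l)%R]) (v (U w))%:E)%E.
Proof.
move=> UV l0 mv v0.
pose D : set (R * R) := [set z | l * z.1 + z.2 < x].
have mD : measurable D.
  rewrite (_ : D = (fun z => l * z.1 + z.2) @^-1` `]-oo, x[).
    rewrite -[X in measurable X]setTI; apply: (_ : measurable_fun _ _) => //.
    by apply: measurable_funD => //; apply: measurable_funM.
  by apply/seteqP; split=> z /=; rewrite in_itv.
pose g (z : R * R) := ((fun z => (v z.1)%:E) \_ D) z.
have gE z : g z = if l * z.1 + z.2 < x then (v z.1)%:E else 0%E.
  by rewrite /g patchE /D mem_boolset.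
have mg : measurable_fun setT g.
  apply/(measurable_restrictT _ mD); apply: measurable_funTS.
  by apply/measurable_EFinP; exact: measurableT_comp.
have g0 z : (0 <= g z)%E by rewrite gE; case: ifPn => // _; rewrite lee_fin v0.
have H := joint_integral UV mg g0.
rewrite integral_mkcond.
transitivity (\int[P]_w g (U w, V w))%E.
  by apply: eq_integral => w _; rewrite gE patchE mem_boolset.
rewrite H; apply: eq_integral => w' _; rewrite [in RHS]integral_mkcond.
apply: eq_integral => w _; rewrite gE patchE mem_boolset /=.
by rewrite -ltrBrDr mulrC -ltr_pdivlMr.
Qed.

End JointLaw.

Section IndependentSums.
Context d (T : measurableType d) (R : realType) (P : probability T R).
Context (I : finType) (Y : I -> {RV P >-> R}).
Implicit Types (c : I -> R) (s : seq I).

Definition lincomb c s (w : T) : R := \sum_(k <- s) c k * Y k w.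

Lemma measurable_lincomb c s : measurable_fun setT (lincomb c s).
Proof. by apply: measurable_sum => k; apply: measurable_funM. Qed.

HB.instance Definition _ c s :=
  isMeasurableFun.Build _ _ _ _ (lincomb c s) (measurable_lincomb c s).

Hypothesis Y_indep : mutually_independent Y.

Let bigcap_one k (F : I -> set T) : \bigcap_(i in [set` [set k]%SET]) F i = F k.
Proof.
apply/seteqP; split=> w /= H; first by apply: H; rewrite /= finset.in_set1.
by move=> i /=; rewrite finset.in_set1 => /eqP->.
Qed.

(** By induction on [s]: a variable is moved from the linear combination to the
    set [J] of free variables, where the induction hypothesis applies, and
    [joint_law_cond] puts it back. *)
Lemma independent_lincomb c s (J : {set I}) (B : I -> set R) (C : set R) :
  uniq s -> (forall k, k \in s -> k \notin J) -> measurable C ->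
  (forall k, measurable (B k)) ->
  P (lincomb c s @^-1` C `&` \bigcap_(i in [set` J]) Y i @^-1` B i) =
  (P (lincomb c s @^-1` C) * \prod_(i in J) P (Y i @^-1` B i))%E.
Proof.
elim: s J B C => [|k s IH] J B C /=.
  move=> _ _ mC mB; have [C0|C0] := pselect (C 0).
    rewrite (_ : lincomb c [::] @^-1` C = setT) ?setTI ?probability_setT ?mul1e ?Y_indep //.
    by apply/seteqP; split => w //= _; rewrite /lincomb big_nil.
  rewrite (_ : lincomb c [::] @^-1` C = set0) ?set0I ?measure0 ?mul0e //.
  by apply/seteqP; split => w //=; rewrite /lincomb big_nil.
move=> /andP[ks us] sJ mC mB.
pose E := \bigcap_(i in [set` J]) Y i @^-1` B i.
have mE : measurable E.
  apply: fin_bigcap_measurable => // i _.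
  by rewrite -[X in measurable X]setTI; exact: measurable_funP.
have kJ : k \notin J by rewrite sJ // mem_head.
have sJ' i : i \in s -> i \notin k |: J.
  move=> si; rewrite in_setU1 negb_or sJ ?in_cons ?si ?orbT // andbT.
  by apply: contraNneq ks => <-.
have PE : P E = (\prod_(i in J) P (Y i @^-1` B i))%E by exact: Y_indep.
have rect A D : measurable A -> measurable D ->
    P (Y k @^-1` A `&` lincomb c s @^-1` D `&` E) =
    (P (Y k @^-1` A) * P (lincomb c s @^-1` D) * P E)%E.
  move=> mA mD; pose B' i := if i == k then A else B i.
  have mB' i : measurable (B' i) by rewrite /B'; case: ifP.
  have := IH (k |: J) B' D us sJ' mD mB'.
  have -> : \bigcap_(i in [set` k |: J]) Y i @^-1` B' i = Y k @^-1` A `&` E.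
    apply/seteqP; split=> w /=.
      move=> H; split; first by have := H k; rewrite /= setU11 /B' eqxx; apply.
      move=> i /= iJ; have := H i; rewrite /= in_setU1 iJ orbT /B'.
      by case: eqP => [ik|_]; [move: kJ; rewrite -ik iJ|apply].
    move=> [wA wE] i /=; rewrite in_setU1 /B'; case: eqP => [->//|_ /= iJ].
    exact: wE.
  rewrite big_setU1 //= {1}/B' eqxx.
  have -> : (\prod_(i in J) P (Y i @^-1` B' i) = P E)%E.
    rewrite PE; apply: eq_bigr => i iJ; rewrite /B'; case: eqP => // ik.
    by move: kJ; rewrite -ik iJ.
  by rewrite setIA (setIC (lincomb c s @^-1` D)) => ->; rewrite muleCA muleA.
pose D : set (R * R) := [set z | C (c k * z.1 + z.2)].
have mD : measurable D.
  rewrite -[X in measurable X]setTI.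
  have mf : measurable_fun setT (fun z : R * R => c k * z.1 + z.2).
    by apply: measurable_funD => //; apply: measurable_funM.
  exact: mf.
have lE : lincomb c (k :: s) @^-1` C = (fun w => (Y k w, lincomb c s w)) @^-1` D.
  by apply/seteqP; split => w /=; rewrite /lincomb big_cons.
rewrite lE -PE (joint_law_cond mE rect mD) joint_law // => A A' mA mA'.
have := IH [set k]%SET (fun=> A) A' us _ mA' (fun=> mA).
rewrite big_set1 bigcap_one setIC muleC; apply.
by move=> i si; rewrite finset.in_set1; apply: contraNneq ks => <-.
Qed.

Lemma independent_rest c s k : uniq s -> k \notin s ->
  independent2 P (Y k) (lincomb c s).
Proof.
move=> us ks A A' mA mA'.
have := @independent_lincomb c s [set k]%SET (fun=> A) A' us _ mA' (fun=> mA).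
rewrite big_set1 bigcap_one setIC muleC; apply.
by move=> i si; rewrite finset.in_set1; apply: contraNneq ks => <-.
Qed.

End IndependentSums.

Section PartialMean.
Context d (T : measurableType d) (R : realType) (P : probability T R).
Context (Z : {mfun T >-> R}) (F : R -> R).
Hypothesis Z_ge0 : forall w, 0 <= Z w.
Hypothesis cF : causal F.
Hypothesis F_cdf : forall x, P [set w | Z w < x] = (F x)%:E.

Lemma measurable_below x : measurable [set w | Z w < x].
Proof.
rewrite (_ : [set w | _] = Z @^-1` `]-oo, x[); last first.
  by apply/seteqP; split=> w /=; rewrite in_itv.
by rewrite -[X in measurable X]setTI; exact: measurable_funP.
Qed.

(** By Fubini, the expectation of the positive part of [x - Z] is the integral
    of [F] up to [x]. *)
Lemma partial_mean x :
  (\int[P]_(w in [set w | (Z w < x)%R]) (Z w)%:E = (x * F x - prim F x)%:E)%E.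
Proof.
have mx := measurable_below x.
have [x0|x0] := leP x 0.
  rewrite cF.2 // mulr0 (causal_prim cF).2 // subrr.
  rewrite (_ : [set w | _] = set0) ?integral_set0 //.
  by apply/seteqP; split=> w //=; rewrite ltNge (le_trans x0).
have fub : (\int[P]_(w in [set w | (Z w < x)%R]) (x - Z w)%:E = (prim F x)%:E)%E.
  pose A : set (T * R) := [set z | Z z.1 < z.2 <= x].
  have mA : measurable A.
    rewrite (_ : A = (fun z => z.2 - Z z.1) @^-1` `]0, +oo[ `&` (fun z => z.2) @^-1` `]-oo, x]).
      apply: measurableI.
        rewrite -[X in measurable X]setTI.
        have mf : measurable_fun setT (fun z : T * R => z.2 - Z z.1).
          by apply: measurable_funB => //; exact: measurableT_comp.
        exact: mf.
      rewrite -[X in measurable X]setTI.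
      have mf : measurable_fun setT (fun z : T * R => z.2) by exact: measurable_snd.
      exact: mf.
    apply/seteqP; split=> z /=; rewrite !in_itv /= subr_gt0 andbT.
      by move=> /andP[].
    by move=> [zx xx]; rewrite /A /= zx.
  have := indic_fubini_tonelli P (@lebesgue_measure R) mA.
  rewrite indic_fubini_tonelli_FE // indic_fubini_tonelli_GE //= => H.
  transitivity (\int[P]_w (@lebesgue_measure R) (xsection A w))%E.
    rewrite integral_mkcond; apply: eq_integral => w _; rewrite patchE mem_boolset.
    rewrite (_ : xsection A w = `]Z w, x]%classic); last first.
      by apply/seteqP; split=> s; rewrite /xsection /= in_itv /= inE.
    by rewrite lebesgue_measure_itv /= lte_fin; case: ifP => // _; rewrite EFinB.
  rewrite H.
  have -> : (\int[lebesgue_measure]_y P (ysection A y) =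
      \int[lebesgue_measure]_(y in `]-oo, x]) (F y)%:E)%E.
    rewrite [RHS]integral_mkcond; apply: eq_integral => s _; rewrite patchE.
    case: ifPn; rewrite ?inE ?notin_setE /= in_itv /= => sx.
      rewrite -F_cdf; congr (P _); apply/seteqP; split=> w; rewrite /ysection /= inE /A /=.
        by case/andP.
      by move=> ->.
    rewrite (_ : ysection A s = set0) ?measure0 //.
    by apply/seteqP; split=> w //; rewrite /ysection /= inE /A /= => /andP[_] /sx.
  rewrite prim.unlock /Rintegral fineK //.
  exact: integrable_fin_num (causal_integrable x cF).
have F0 : 0 <= F x by rewrite -lee_fin -F_cdf measure_ge0.
have Ix : (\int[P]_(w in [set w | (Z w < x)%R]) x%:E = (x * F x)%:E)%E.
  by rewrite integral_cst //= EFinM -F_cdf.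
have : (\int[P]_(w in [set w | (Z w < x)%R]) ((x - Z w)%:E + (Z w)%:E) = (x * F x)%:E)%E.
  by rewrite -Ix; apply: eq_integral => w _; rewrite -EFinD subrK.
rewrite ge0_integralD //=.
- rewrite fub; case: (integral _ _ _) => [r| |] //=.
  by rewrite -EFinD => -[<-]; rewrite addrC addKr.
- by move=> w wx; rewrite lee_fin subr_ge0 ltW.
- by apply/measurable_EFinP; apply: measurable_funTS; apply: measurable_funB.
- by move=> w _; rewrite lee_fin.
- by apply/measurable_EFinP; apply: measurable_funTS.
Qed.

End PartialMean.

(** * Expectations of bounded functions *)

Section BoundedExpectation.
Context d (T : measurableType d) (R : realType) (P : probability T R).
Implicit Types (f g : T -> R).

Lemma bounded_integrable f (M : R) : measurable_fun setT f ->
  (forall w, `|f w| <= M) -> P.-integrable setT (EFin \o f).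
Proof.
move=> mf fM; apply: measurable_bounded_integrable => //.
  by apply: (le_lt_trans (probability_le1 P measurableT)); rewrite ltry.
exists M; split; first exact: num_real.
by move=> y My w _; exact: le_trans (fM w) (ltW My).
Qed.

Lemma bounded_cvg (fn : nat -> T -> R) f (M : R) :
  (forall n, measurable_fun setT (fn n)) -> (forall n w, `|fn n w| <= M) ->
  (forall w, fn n w @[n --> \oo] --> f w) ->
  \int[P]_w fn n w @[n --> \oo] --> \int[P]_w f w.
Proof.
move=> mfn fnM fnf.
have mf : measurable_fun setT f by exact: measurable_fun_cvg (fun n => mfn n) (fun w _ => fnf w).
have fM w : `|f w| <= M.
  have H : `|fn n w| @[n --> \oo] --> `|f w| by exact: cvg_norm (fnf w).
  by apply: (@cvgr_to_le nat (nbhs \oo) _ R (fun n => `|fn n w|) _ M H); exact: nearW.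
have If := bounded_integrable mf fM.
have mE n : measurable_fun setT (fun w => (fn n w)%:E) by exact/measurable_EFinP.
apply: fine_cvg; rewrite fineK ?integrable_fin_num //.
apply: (@dominated_cvg _ _ _ P setT measurableT _ _ (cst M%:E) mE) => //.
- by move=> w _; apply: cvg_EFin; [exact: nearW|exact: fnf].
- by apply: (@bounded_integrable (cst M) `|M|).
- by move=> n w _; rewrite lee_fin.
Qed.

Lemma bounded_is_derive (f df : R -> T -> R) (a u v M M' : R) :
  a \in `]u, v[ -> (forall x, measurable_fun setT (f x)) ->
  (forall x w, `|f x w| <= M') ->
  (forall x w, x \in `]u, v[ -> is_derive x 1 (f ^~ w) (df x w)) ->
  (forall x w, x \in `]u, v[ -> `|df x w| <= M) ->
  is_derive a 1 (fun x => \int[P]_w f x w) (\int[P]_w df a w).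
Proof.
move=> auv mf fM dff dfM.
have If x : `]u, v[%classic x -> P.-integrable setT (EFin \o f x).
  by move=> _; exact: bounded_integrable (mf x) (fM x).
have d1 x w : `]u, v[%classic x -> setT w -> derivable (f ^~ w) x 1.
  by move=> xuv _; have [] := dff x w xuv.
have Ia : `]u, v[%classic a by [].
have M0 : 0 <= `|M| by [].
have IM : P.-integrable setT (EFin \o cst `|M|).
  by apply: (@bounded_integrable (cst `|M|) `|M|) => // w; rewrite normr_id.
have E x w : x \in `]u, v[ -> (f ^~ w)^`()%classic x = df x w.
  by move=> xuv; rewrite derive1E; have [_ ->] := dff x w xuv.
have ub x w : `]u, v[%classic x -> setT w -> `|(f ^~ w)^`()%classic x| <= `|M|.
  by move=> xuv _; rewrite E // (le_trans (dfM _ _ xuv)) // ler_norm.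
have D := derivable_under_integral measurableT Ia If d1 (fun=> M0) IM ub.
have DE := differentiation_under_integral measurableT Ia If d1 (fun=> M0) IM ub.
apply: (DeriveDef D); rewrite -derive1E DE.
by apply: eq_Rintegral => w _; exact: E.
Qed.

End BoundedExpectation.

(** * Weighted sums of gamma variables *)

Section WeightedSum.
Context d (T : measurableType d) (R : realType) (P : probability T R).
Context (I : finType) (Y : I -> {RV P >-> R}) (alpha C : R) (Phi : R -> R).
Hypothesis alpha_gt0 : 0 < alpha.
Hypothesis Y_indep : mutually_independent Y.
Hypothesis Y_ge0 : forall k w, 0 <= Y k w.
Hypothesis cPhi : causal Phi.
Hypothesis Phi_cdf : forall k t, P [set w | Y k w < t] = (Phi t)%:E.
Hypothesis dPhi : forall t : R, 0 < t ->
  is_derive t 1 Phi (C * t `^ (alpha - 1) * expR (- t)).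
Hypothesis Phi_gt0 : forall t, 0 < t -> 0 < Phi t.
Implicit Types (lam : I -> R) (u : R -> R) (x : R) (i j k : I).

Definition others i : seq I := [seq k <- index_enum I | k != i].

Definition cdf_sum lam x : R := fine (P [set w | \sum_k lam k * Y k w < x]).

(** The expectation of [u] at the threshold that [Y i] must stay below for the
    sum to stay below [x], given the other variables. *)
Definition smix u lam i x : R :=
  \int[P]_w u ((x - lincomb Y lam (others i) w) / lam i).

Let Psi := esmooth 1 Phi.

Lemma sum_others lam i w :
  \sum_k lam k * Y k w = lam i * Y i w + lincomb Y lam (others i) w.
Proof. by rewrite (bigD1 i) //= /lincomb big_filter. Qed.

Lemma independent_others lam i : independent2 P (Y i) (lincomb Y lam (others i)).
Proof.
apply: independent_rest => //; first by rewrite filter_uniq // index_enum_uniq.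
by rewrite mem_filter eqxx.
Qed.

Lemma measurable_sum_below lam x : measurable [set w | \sum_k lam k * Y k w < x].
Proof. exact: (measurable_below (lincomb Y lam (index_enum I))). Qed.

Lemma Psi_causal : causal Psi. Proof. exact: causal_esmooth. Qed.

Lemma Phi_itv t (k : I) : 0 <= Phi t <= 1.
Proof. by rewrite -!lee_fin -(Phi_cdf k) measure_ge0 probability_le1 //; exact: measurable_below. Qed.

Lemma Phi_ndecr (k : I) s t : s <= t -> Phi s <= Phi t.
Proof.
move=> st; rewrite -lee_fin -!(Phi_cdf k); apply: le_measure; rewrite ?inE;
  try exact: measurable_below.
by move=> w /= ws; exact: lt_le_trans st.
Qed.

Lemma Psi_itv (k : I) t : 0 <= Psi t <= Phi t.
Proof.
have [t0|t0] := leP t 0; first by rewrite Psi_causal.2 // cPhi.2 // lexx.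
apply/andP; split.
- apply: (@relax_ge0 _ 1 _ (fun y => (Phi y - Psi y) / 1)) (ltW t0) _ _ _ _ => //.
  + by apply: continuous_subspaceT; case: Psi_causal.
  + by move=> y _; exact: is_derive_esmooth.
  + by move=> y _; rewrite divr1 mul1r subrK; case/andP: (Phi_itv y k).
  + by rewrite Psi_causal.2.
- apply: esmooth_le => //; [exact: ltW|by case/andP: (Phi_itv t k)|].
  by move=> y /andP[_ yt]; apply: (Phi_ndecr k); exact: ltW.
Qed.

Lemma Phi_norm (k : I) t : `|Phi t| <= 1.
Proof. by have /andP[? ?] := Phi_itv t k; rewrite ger0_norm. Qed.

Lemma Psi_norm (k : I) t : `|Psi t| <= 1.
Proof.
have /andP[? ?] := Phi_itv t k; have /andP[? ?] := Psi_itv k t.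
by rewrite ger0_norm // (le_trans _ (_ : Phi t <= 1)).
Qed.

Lemma gap_norm (k : I) t : `|Phi t - Psi t| <= 1.
Proof.
have /andP[? ?] := Phi_itv t k; have /andP[? ?] := Psi_itv k t.
by rewrite ger0_norm ?subr_ge0 // lerBlDr (le_trans _ (_ : 1 <= _)) // lerDl.
Qed.

Lemma measurable_smix u (r : T -> R) l x : continuous u -> measurable_fun setT r ->
  measurable_fun setT (fun w => u ((x - r w) / l)).
Proof.
move=> cu mr; have mu := continuous_measurable_fun cu.
apply: (measurableT_comp mu); apply: measurable_funM => //.
exact: measurable_funB.
Qed.

Lemma integrable_smix u (M : R) (r : T -> R) l x : continuous u ->
  (forall t, `|u t| <= M) -> measurable_fun setT r ->
  P.-integrable setT (EFin \o (fun w => u ((x - r w) / l))).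
Proof.
by move=> cu uM mr; apply: (@bounded_integrable _ _ _ _ _ M) => //; exact: measurable_smix.
Qed.

Lemma expect_EFin u (M : R) (r : T -> R) l x : continuous u -> (forall t, `|u t| <= M) ->
  measurable_fun setT r ->
  (\int[P]_w (u ((x - r w) / l))%:E = (\int[P]_w u ((x - r w) / l))%:E)%E.
Proof.
move=> cu uM mr; rewrite /Rintegral fineK //; apply: integrable_fin_num => //.
exact: integrable_smix cu uM mr.
Qed.

Lemma cdf_sumE lam i x : 0 < lam i -> cdf_sum lam x = smix Phi lam i x.
Proof.
move=> l0; apply: EFin_inj; rewrite /cdf_sum fineK; last first.
  by apply: fin_num_measure; exact: measurable_sum_below.
have := @mixing_integral _ _ _ P (Y i) (lincomb Y lam (others i)) (cst 1) (lam i) x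
  (independent_others lam i) l0 (measurable_cst _) (fun=> ler01).
have intP (D : set T) (Z : T -> R) : measurable D ->
    (\int[P]_(w in D) (cst (1 : R) (Z w))%:E = P D)%E.
  by move=> mD; rewrite -[RHS]mul1e -(integral_cst P mD).
rewrite (_ : [set w | _] = [set w | \sum_k lam k * Y k w < x]); last first.
  by apply/seteqP; split=> w /=; rewrite (sum_others lam i).
rewrite intP; last exact: measurable_sum_below.
move=> ->; rewrite -(@expect_EFin Phi 1) //; [|exact: cPhi.1|exact: Phi_norm].
apply: eq_integral => w _; rewrite intP ?Phi_cdf //.
exact: measurable_below.
Qed.

(** Conditioning on the other variables turns the contribution of [Y i] into the
    partial mean of a single gamma variable, given by [gamma_partial_mean]. *)
Lemma partial_sum_mean lam i x : 0 < lam i ->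
  (\int[P]_(w in [set w | (\sum_k lam k * Y k w < x)%R]) (Y i w)%:E =
   (alpha * smix Psi lam i x)%:E)%E.
Proof.
move=> l0.
have := @mixing_integral _ _ _ P (Y i) (lincomb Y lam (others i)) (fun y => `|y|) (lam i) x
  (independent_others lam i) l0 (@normr_measurable _ _) (fun=> normr_ge0 _).
rewrite (_ : [set w | _] = [set w | \sum_k lam k * Y k w < x]); last first.
  by apply/seteqP; split=> w /=; rewrite (sum_others lam i).
under eq_integral do rewrite ger0_norm //.
move=> ->; rewrite EFinM -(@expect_EFin Psi 1) //; [|exact: Psi_causal.1|exact: Psi_norm].
rewrite -ge0_integralZl //; last 3 first.
- apply/measurable_EFinP; apply: measurable_smix => //; exact: Psi_causal.1.
- by move=> w _; rewrite lee_fin; case/andP: (Psi_itv i ((x - lincomb Y lam (others i) w) / lam i)).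
- by rewrite lee_fin ltW.
apply: eq_integral => w _.
rewrite (eq_integral (fun w => (Y i w)%:E)); last first.
  by move=> w' _; rewrite ger0_norm.
rewrite (@partial_mean _ _ _ P (Y i) Phi (Y_ge0 i) cPhi (Phi_cdf i)).
by rewrite (gamma_partial_mean alpha_gt0 cPhi dPhi) EFinM.
Qed.

Lemma lincomb_cvg (lamn : nat -> I -> R) lam s w :
  (forall k, lamn n k @[n --> \oo] --> lam k) ->
  lincomb Y (lamn n) s w @[n --> \oo] --> lincomb Y lam s w.
Proof.
move=> H; rewrite /lincomb; elim: s => [|k s IH].
  by under eq_fun do rewrite big_nil; rewrite big_nil; exact: cvg_cst.
under eq_fun do rewrite big_cons; rewrite big_cons.
by apply: cvgD => //; apply: cvgM; [exact: H|exact: cvg_cst].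
Qed.

Lemma smix_cvg u (M : R) (lamn : nat -> I -> R) lam i (xn : nat -> R) x :
  continuous u -> (forall t, `|u t| <= M) -> 0 < lam i ->
  (forall k, lamn n k @[n --> \oo] --> lam k) -> xn n @[n --> \oo] --> x ->
  smix u (lamn n) i (xn n) @[n --> \oo] --> smix u lam i x.
Proof.
move=> cu uM l0 lamc xc; apply: (@bounded_cvg _ _ _ P _ _ M).
- by move=> n; apply: measurable_smix.
- by move=> n w; exact: uM.
- move=> w; apply: (@continuous_cvg _ _ _ _ _ _ u); first exact: cu.
  apply: cvgM; first by apply: cvgB => //; exact: lincomb_cvg.
  by apply: cvgV; [rewrite gt_eqF|exact: lamc].
Qed.

(** Differentiation under the expectation; the derivative of [Psi] is
    [Phi - Psi]. *)
Lemma derive_shift (k : I) (r : T -> R) l x : 0 < l -> measurable_fun setT r ->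
  is_derive x 1 (fun x => \int[P]_w Psi ((x - r w) / l))
    ((\int[P]_w Phi ((x - r w) / l) - \int[P]_w Psi ((x - r w) / l)) / l).
Proof.
move=> l0 mr.
have dPsi (t : R) : is_derive t 1 Psi (Phi t - Psi t).
  by have := @is_derive_esmooth _ 1 _ t ltr01 cPhi; rewrite divr1.
have := @bounded_is_derive _ _ _ P (fun x w => Psi ((x - r w) / l))
  (fun x w => l^-1 * (Phi ((x - r w) / l) - Psi ((x - r w) / l))) x (x - 1) (x + 1)
  l^-1 1.
have -> : \int[P]_w (l^-1 * (Phi ((x - r w) / l) - Psi ((x - r w) / l))) =
   (\int[P]_w Phi ((x - r w) / l) - \int[P]_w Psi ((x - r w) / l)) / l.
  have I1 : P.-integrable setT (EFin \o (fun w => Phi ((x - r w) / l))).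
    exact: integrable_smix cPhi.1 (Phi_norm k) mr.
  have I2 : P.-integrable setT (EFin \o (fun w => Psi ((x - r w) / l))).
    exact: integrable_smix Psi_causal.1 (Psi_norm k) mr.
  rewrite -RintegralB // mulrC -RintegralZl //.
  by have := integrableB measurableT I1 I2.
apply.
- by rewrite in_itv /= ltrDl ltrBlDr ltrDl ltr01.
- by move=> y; apply: measurable_smix => //; exact: Psi_causal.1.
- by move=> y w; exact: (Psi_norm k).
- move=> y w _; have dl : is_derive y 1 (fun y => (y - r w) / l) l^-1.
    by apply: is_derive_eq; rewrite /GRing.scale /=; ring.
  have := @is_derive1_comp _ Psi (fun y => (y - r w) / l) y _ _ (dPsi _) dl.
  by rewrite mulrC.
- move=> y w _; rewrite normrM gtr0_norm ?invr_gt0 // ler_piMr ?invr_ge0 ?(ltW l0) //.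
  exact: (gap_norm k).
Qed.

(** The derivative of [Phi ((x - r w) / l)] in [l] is
    [- (y * Phi' y) / l] at [y = (x - r w) / l], which [gamma_density_gap] turns into the
    bounded expression [- (alpha / l) * (Phi y - Psi y)], also for shapes below 1,
    where the density [Phi'] is unbounded. *)
Lemma derive_scale (k : I) (r : T -> R) (t x : R) : 0 < t -> measurable_fun setT r ->
  is_derive t 1 (fun l => \int[P]_w Phi ((x - r w) / l))
    (- (alpha / t) * (\int[P]_w Phi ((x - r w) / t) - \int[P]_w Psi ((x - r w) / t))).
Proof.
move=> t0 mr.
have := @bounded_is_derive _ _ _ P (fun l w => Phi ((x - r w) / l))
  (fun l w => - (alpha / l) * (Phi ((x - r w) / l) - Psi ((x - r w) / l))) t (t / 2) (t + 1)
  (alpha / (t / 2)) 1.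
have -> : \int[P]_w (- (alpha / t) * (Phi ((x - r w) / t) - Psi ((x - r w) / t))) =
   - (alpha / t) * (\int[P]_w Phi ((x - r w) / t) - \int[P]_w Psi ((x - r w) / t)).
  have I1 : P.-integrable setT (EFin \o (fun w => Phi ((x - r w) / t))).
    exact: integrable_smix cPhi.1 (Phi_norm k) mr.
  have I2 : P.-integrable setT (EFin \o (fun w => Psi ((x - r w) / t))).
    exact: integrable_smix Psi_causal.1 (Psi_norm k) mr.
  rewrite -RintegralB // -RintegralZl //.
  by have := integrableB measurableT I1 I2.
apply.
- by rewrite in_itv /=; lra.
- by move=> y; apply: measurable_smix => //; exact: cPhi.1.
- by move=> y w; exact: (Phi_norm k).
- move=> y w; rewrite in_itv /= => /andP[yt _].
  have y0 : 0 < y by apply: lt_trans yt; rewrite divr_gt0.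
  have [z0|z0] := leP (x - r w) 0.
    have Phi0 y' : 0 < y' -> Phi ((x - r w) / y') = 0.
      by move=> y'0; apply: cPhi.2; rewrite mulr_le0_ge0 // invr_ge0 ltW.
    rewrite Phi0 // Psi_causal.2; last by rewrite mulr_le0_ge0 // invr_ge0 ltW.
    rewrite subrr mulr0; apply: (near_eq_is_derive _ (is_derive_cst (0 : R) y 1)).
    near=> z; rewrite Phi0 //; near: z; exact: lt_nbhsr.
  have dl : is_derive y 1 (fun y => (x - r w) / y) (- ((x - r w) / y ^+ 2)).
    have yn0 : y != 0 by rewrite gt_eqF.
    have ? : is_derive y 1 (fun y : R => y^-1) _ := @is_deriveV _ id y _ _ yn0 (is_derive_id _ _).
    by apply: is_derive_eq; rewrite /GRing.scale /=; field.
  have zy0 : 0 < (x - r w) / y by rewrite divr_gt0.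
  have := @is_derive1_comp _ Phi (fun y => (x - r w) / y) y _ _ (dPhi zy0) dl.
  move=> D; apply: (is_derive_eq D).
  have := gamma_density_gap alpha_gt0 cPhi dPhi zy0; rewrite -/Psi.
  move: (C * _ * _) (Phi _ - Psi _) => f g E.
  have -> : - (alpha / y) * g = - (alpha * g) / y by field; rewrite gt_eqF.
  by rewrite -E; field; rewrite gt_eqF.
- move=> y w; rewrite in_itv /= => /andP[yt _].
  have y0 : 0 < y by apply: lt_trans yt; rewrite divr_gt0.
  rewrite normrM normrN (gtr0_norm (divr_gt0 alpha_gt0 y0)).
  apply: (@le_trans _ _ (alpha / y)).
    by rewrite (ler_piMr (ltW (divr_gt0 alpha_gt0 y0)) (gap_norm k _)).
  by rewrite ler_pM2l // lef_pV2 ?posrE ?divr_gt0 // ltW.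
Unshelve. all: by end_near. Qed.

Section Cdf.
Variable lam : I -> R.
Hypothesis lam_ge0 : forall k, 0 <= lam k.
Hypothesis lam_sum : \sum_k lam k = 1.

Lemma some_lam_gt0 : exists k, 0 < lam k.
Proof.
apply/not_existsP => H; have := lam_sum; rewrite big1 => [/eqP|k _].
  by rewrite eq_sym oner_eq0.
by apply/eqP; rewrite eq_le lam_ge0 leNgt andbT; apply/negP/H.
Qed.

Lemma sum_cdfE x : P [set w | \sum_k lam k * Y k w < x] = (cdf_sum lam x)%:E.
Proof. by rewrite /cdf_sum fineK // fin_num_measure //; exact: measurable_sum_below. Qed.

Lemma cdf_sum_ndecr x y : x <= y -> cdf_sum lam x <= cdf_sum lam y.
Proof.
move=> xy; rewrite -lee_fin -!sum_cdfE; apply: le_measure; rewrite ?inE;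
  try exact: measurable_sum_below.
by move=> w /= wx; exact: lt_le_trans xy.
Qed.

Lemma cdf_sum_causal : causal (cdf_sum lam).
Proof.
have [k l0] := some_lam_gt0; split=> [x|x x0].
  have E : cdf_sum lam = smix Phi lam k by apply/funext => y; exact: cdf_sumE.
  apply/(@cvg_nbhsP _ R^o) => u ux.
  have := @smix_cvg Phi 1 (fun=> lam) lam k u x; rewrite -E; apply => //.
  - exact: cPhi.1.
  - exact: Phi_norm.
  - by move=> k'; exact: cvg_cst.
rewrite /cdf_sum (_ : [set w | _] = set0) ?measure0 //.
apply/seteqP; split=> w //=; apply/negP; rewrite -leNgt (le_trans x0) //.
by apply: sumr_ge0 => k' _; rewrite mulr_ge0.
Qed.

Lemma cdf_sum_gt0 x : 0 < x -> 0 < cdf_sum lam x.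
Proof.
move=> x0; rewrite -lte_fin -sum_cdfE.
have sub : \bigcap_(k in [set` [set: I]%SET]) Y k @^-1` `]-oo, x[ `<=`
    [set w | \sum_k lam k * Y k w < x].
  move=> w H /=; have Yx k : Y k w < x.
    by have := H k; rewrite /= finset.in_setT in_itv /=; apply.
  have [k l0] := some_lam_gt0.
  rewrite -[ltRHS]mul1r -lam_sum mulr_suml (bigD1 k) //= [ltRHS](bigD1 k) //=.
  apply: ltr_leD; first by rewrite ltr_pM2l.
  by apply: ler_sum => k' _; rewrite ler_wpM2l // ltW.
apply: (@lt_le_trans _ _ (P (\bigcap_(k in [set` [set: I]%SET]) Y k @^-1` `]-oo, x[))).
  rewrite Y_indep //.
  elim/big_ind : _ => [|? ?|k _]; [exact: lte01|exact: mule_gt0|].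
  have -> : Y k @^-1` `]-oo, x[ = [set w | Y k w < x].
    by apply/seteqP; split=> w /=; rewrite in_itv.
  by rewrite Phi_cdf lte_fin Phi_gt0.
apply: le_measure => //; rewrite inE; last exact: measurable_sum_below.
apply: fin_bigcap_measurable => // k _.
by rewrite -[X in measurable X]setTI; exact: measurable_funP.
Qed.

(** Smoothing [Phi] inside the expectation with memory 1 is smoothing the whole
    sum with memory [lam i], by uniqueness for the differential equation that
    [derive_shift] provides. *)
Lemma esmooth_cdf_sum i : 0 < lam i -> esmooth (lam i) (cdf_sum lam) = smix Psi lam i.
Proof.
move=> l0; have mr : measurable_fun setT (lincomb Y lam (others i)) by exact: measurable_funP.
have dG x := derive_shift i x l0 mr.
apply/esym; apply: (esmooth_uniq (ltW l0) cdf_sum_causal _ (fun x _ => dG x)).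
  split=> x; first exact: is_derive_continuous (dG x).
  move=> x0; rewrite /smix (@eq_Rintegral _ _ _ _ _ (cst 0)).
    by rewrite Rintegral_cst // mul0r.
  move=> w _ /=; apply: Psi_causal.2; rewrite mulr_le0_ge0 ?invr_ge0 ?lam_ge0 //.
  rewrite subr_le0 (le_trans x0) //; apply: sumr_ge0 => k _; by rewrite mulr_ge0.
by move=> x x0; rewrite (cdf_sumE _ l0) /smix; field; rewrite gt_eqF.
Qed.

(** The partial mean of the sum is the sum of the contributions of its terms. *)
Lemma cdf_sum_size_bias x : x * cdf_sum lam x - prim (cdf_sum lam) x =
  \sum_k alpha * lam k * esmooth (lam k) (cdf_sum lam) x.
Proof.
apply: EFin_inj.
rewrite -(@partial_mean _ _ _ P (lincomb Y lam (index_enum I)) _ _ cdf_sum_causal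
  sum_cdfE); last first.
  by move=> w; apply: sumr_ge0 => k _; rewrite mulr_ge0.
have -> : (\int[P]_(w in [set w | (lincomb Y lam (index_enum I) w < x)%R])
    (lincomb Y lam (index_enum I) w)%:E =
  \int[P]_(w in [set w | (\sum_k lam k * Y k w < x)%R]) \sum_k (lam k * Y k w)%:E)%E.
  by apply: eq_integral => w _; rewrite sumEFin.
rewrite ge0_integral_sum //=; first last.
- by move=> k w _; rewrite lee_fin mulr_ge0.
- by move=> k; apply/measurable_EFinP; apply: measurable_funTS; apply: measurable_funM.
- exact: measurable_sum_below.
rewrite -sumEFin; apply: eq_bigr => k _.
have := lam_ge0 k; rewrite le_eqVlt => /predU1P[l0|l0].
  rewrite -l0 mulr0 mul0r -[RHS](integral0 P [set w | \sum_k lam k * Y k w < x]).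
  by apply: eq_integral => w _; rewrite mul0r.
under eq_integral do rewrite EFinM.
rewrite ge0_integralZl //; first last.
- by rewrite lee_fin.
- by move=> w _; rewrite lee_fin.
- by apply/measurable_EFinP; apply: measurable_funTS.
- exact: measurable_sum_below.
by rewrite partial_sum_mean // esmooth_cdf_sum // -EFinM; congr EFin; ring.
Qed.

End Cdf.

(** * Moving two weights *)

Section PairMove.
Variables (lam : I -> R) (i j : I) (s x : R).
Hypothesis neq_ij : i != j.

Definition pairw a b k := if k == i then a else if k == j then b else lam k.

Let pairw_i a b : pairw a b i = a. Proof. by rewrite /pairw eqxx. Qed.
Let pairw_j a b : pairw a b j = b.
Proof. by rewrite /pairw eqxx eq_sym (negPf neq_ij). Qed.

Let D1 a b := - (alpha / a) *
  (smix Phi (pairw a b) i x - smix Psi (pairw a b) i x).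
Let D2 a b := - (alpha / b) *
  (smix Phi (pairw a b) j x - smix Psi (pairw a b) j x).

Let rest_i a b w : lincomb Y (pairw a b) (others i) w = lincomb Y (pairw 0 b) (others i) w.
Proof.
rewrite /lincomb !big_filter; apply: eq_bigr => k ki.
by rewrite /pairw (negPf ki).
Qed.

Let rest_j a b w : lincomb Y (pairw a b) (others j) w = lincomb Y (pairw a 0) (others j) w.
Proof.
rewrite /lincomb !big_filter; apply: eq_bigr => k kj.
by rewrite /pairw (negPf kj).
Qed.

Let smix_i u a b : smix u (pairw a b) i x =
  \int[P]_w u ((x - lincomb Y (pairw 0 b) (others i) w) / a).
Proof. by apply: eq_Rintegral => w _; rewrite rest_i pairw_i. Qed.

Let smix_j u a b : smix u (pairw a b) j x =
  \int[P]_w u ((x - lincomb Y (pairw a 0) (others j) w) / b).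
Proof. by apply: eq_Rintegral => w _; rewrite rest_j pairw_j. Qed.

Let derive_i (a b : R) : 0 < a ->
  is_derive a 1 (fun a => cdf_sum (pairw a b) x) (D1 a b).
Proof.
move=> a0; have H : is_derive a 1
    (fun a => \int[P]_w Phi ((x - lincomb Y (pairw 0 b) (others i) w) / a)) (D1 a b).
  by rewrite /D1 !smix_i; apply: (derive_scale i) => //; exact: measurable_funP.
apply: (near_eq_is_derive _ H); near=> z.
rewrite (@cdf_sumE _ i) ?pairw_i ?smix_i //.
by near: z; exact: lt_nbhsr.
Unshelve. all: by end_near. Qed.

Let derive_j (a b : R) : 0 < b ->
  is_derive b 1 (fun b => cdf_sum (pairw a b) x) (D2 a b).
Proof.
move=> b0; have H : is_derive b 1
    (fun b => \int[P]_w Phi ((x - lincomb Y (pairw a 0) (others j) w) / b)) (D2 a b).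
  by rewrite /D2 !smix_j; apply: (derive_scale j) => //; exact: measurable_funP.
apply: (near_eq_is_derive _ H); near=> z.
rewrite (@cdf_sumE _ j) ?pairw_j ?smix_j //.
by near: z; exact: lt_nbhsr.
Unshelve. all: by end_near. Qed.

Let pairw_cvg (an bn : nat -> R) a b k : an n @[n --> \oo] --> a ->
  bn n @[n --> \oo] --> b -> pairw (an n) (bn n) k @[n --> \oo] --> pairw a b k.
Proof. by move=> ? ?; rewrite /pairw; case: ifP => // _; case: ifP => // _; exact: cvg_cst. Qed.

(** A chain rule along the line [z |-> (z, s - z)].  The partial derivatives are
    [D1] and [D2]; the mean value theorem is applied in one coordinate at a time,
    and their joint sequential continuity ([smix_cvg]) gives the limit. *)
Lemma is_derive_pair (t : R) : 0 < t < s ->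
  is_derive t 1 (fun z => cdf_sum (pairw z (s - z)) x) (D1 t (s - t) - D2 t (s - t)).
Proof.
move=> /andP[t0 ts]; pose G z := cdf_sum (pairw z (s - z)) x.
suff H : h^-1 *: (G (h *: 1 + t) - G t) @[h --> 0^'] --> D1 t (s - t) - D2 t (s - t).
  by apply: DeriveDef; [exact: cvgP H|exact: cvg_lim H].
apply/cvgr_dnbhsP => u [u_neq0 u_cvg0].
have step n : exists c : R * R, [/\ `|c.1 - t| <= `|u n|, `|c.2 - t| <= `|u n| &
    `|u n| < Num.min t (s - t) ->
    (u n)^-1 *: (G (u n *: 1 + t) - G t) =
    D1 c.1 (s - (t + u n)) - D2 t (s - c.2)].
  have [un|un] := ltP `|u n| (Num.min t (s - t)); last first.
    by exists (t, t); rewrite /= subrr normr0; split.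
  move: (un); rewrite lt_min => /andP[ut us].
  have near_t z : `|z - t| <= `|u n| -> 0 < z /\ 0 < s - z.
    move=> zu; have := le_lt_trans zu ut; have := le_lt_trans zu us.
    by rewrite !ltr_norml => /andP[_ zs] /andP[zt _]; split; [move: zt|move: zs]; lra.
  have d1 z : `|z - t| <= `|u n| ->
      is_derive z 1 (fun a => cdf_sum (pairw a (s - (t + u n))) x) (D1 z (s - (t + u n))).
    by move=> /near_t[z0 _]; exact: derive_i.
  have [c1 c1P E1] := mvt_near d1.
  have d2 z : `|z - t| <= `|u n| ->
      is_derive z 1 (fun z => cdf_sum (pairw t (s - z)) x) (- D2 t (s - z)).
    move=> /near_t[_ sz0].
    have dl : is_derive z 1 (fun z => s - z) (- 1) by apply: is_derive_eq; ring.
    have := @is_derive1_comp _ (fun b => cdf_sum (pairw t b) x) (fun z => s - z) z _ _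
      (derive_j t sz0) dl.
    by rewrite mulrN1.
  have [c2 c2P E2] := mvt_near d2.
  exists (c1, c2); split=> // _ /=.
  have un0 := u_neq0 n.
  rewrite /G /GRing.scale /= mulr1 (addrC _ t).
  rewrite -(subrKA (cdf_sum (pairw t (s - (t + u n))) x)) E1 E2 /=; field; exact: un0.
have [c cP] := choice step.
have c1 : (c n).1 @[n --> \oo] --> t by apply: cvg_dist_le u_cvg0 => n; have [] := cP n.
have c2 : (c n).2 @[n --> \oo] --> t by apply: cvg_dist_le u_cvg0 => n; have [] := cP n.
have tu : t + u n @[n --> \oo] --> t.
  by rewrite -[X in _ --> X]addr0; apply: cvgD => //; exact: cvg_cst.
have H : D1 (c n).1 (s - (t + u n)) - D2 t (s - (c n).2) @[n --> \oo] -->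
    D1 t (s - t) - D2 t (s - t).
  have st0 : 0 < s - t by rewrite subr_gt0.
  have cc : s - (c n).2 @[n --> \oo] --> s - t by apply: cvgB => //; exact: cvg_cst.
  have ct : s - (t + u n) @[n --> \oo] --> s - t by apply: cvgB => //; exact: cvg_cst.
  apply: cvgB; apply: cvgM.
  - by apply: cvgN; apply: cvgM; [exact: cvg_cst|apply: cvgV => //; rewrite gt_eqF].
  - apply: cvgB.
    + apply: (@smix_cvg Phi 1 (fun n => pairw (c n).1 (s - (t + u n))) _ i (fun=> x)).
      * exact: cPhi.1.
      * exact: (Phi_norm i).
      * by rewrite pairw_i.
      * by move=> k; exact: pairw_cvg.
      * exact: cvg_cst.
    + apply: (@smix_cvg Psi 1 (fun n => pairw (c n).1 (s - (t + u n))) _ i (fun=> x)).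
      * exact: Psi_causal.1.
      * exact: (Psi_norm i).
      * by rewrite pairw_i.
      * by move=> k; exact: pairw_cvg.
      * exact: cvg_cst.
  - by apply: cvgN; apply: cvgM; [exact: cvg_cst|apply: cvgV => //; rewrite gt_eqF].
  - have tt : (fun _ : nat => t) @ \oo --> t by exact: cvg_cst.
    apply: cvgB.
    + apply: (@smix_cvg Phi 1 (fun n => pairw t (s - (c n).2)) _ j (fun=> x)).
      * exact: cPhi.1.
      * exact: (Phi_norm i).
      * by rewrite pairw_j.
      * by move=> k; exact: pairw_cvg.
      * exact: cvg_cst.
    + apply: (@smix_cvg Psi 1 (fun n => pairw t (s - (c n).2)) _ j (fun=> x)).
      * exact: Psi_causal.1.
      * exact: (Psi_norm i).
      * by rewrite pairw_j.
      * by move=> k; exact: pairw_cvg.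
      * exact: cvg_cst.
apply: (cvg_trans _ H); apply: near_eq_cvg; near=> n.
have [_ _ ->//] := cP n.
near: n; have m0 : 0 < Num.min t (s - t) by rewrite lt_min t0 subr_gt0.
by move/cvgr0_norm_lt : u_cvg0; apply.
Unshelve. all: by end_near. Qed.

Lemma continuous_pair (t : R) : 0 < t ->
  {for t, continuous (fun z => cdf_sum (pairw z (s - z)) x)}.
Proof.
move=> t0; apply/(@cvg_nbhsP _ R^o) => u ut.
rewrite (@cdf_sumE _ i) ?pairw_i //.
have H : smix Phi (pairw (u n) (s - u n)) i x @[n --> \oo] -->
    smix Phi (pairw t (s - t)) i x.
  apply: (@smix_cvg Phi 1 (fun n => pairw (u n) (s - u n)) _ i (fun=> x)).
  - exact: cPhi.1.
  - exact: (Phi_norm i).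
  - by rewrite pairw_i.
  - by move=> k; apply: pairw_cvg => //; apply: cvgB => //; exact: cvg_cst.
  - exact: cvg_cst.
apply: (cvg_trans _ H); apply: near_eq_cvg; near=> n.
rewrite (@cdf_sumE _ i) // pairw_i; near: n.
by move/cvgr_gt : ut; apply.
Unshelve. all: by end_near. Qed.

End PairMove.

Definition weights lam := (forall k, 0 <= lam k) /\ \sum_k lam k = 1.

Lemma cdf_sum_cvg (lamn : nat -> I -> R) lam x : weights lam ->
  (forall k, lamn n k @[n --> \oo] --> lam k) ->
  cdf_sum (lamn n) x @[n --> \oo] --> cdf_sum lam x.
Proof.
move=> [lam0 lam1] lamc; have [i li] := some_lam_gt0 lam0 lam1.
have H : smix Phi (lamn n) i x @[n --> \oo] --> smix Phi lam i x.
  apply: (@smix_cvg Phi 1 lamn lam i (fun=> x)) => //.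
  - exact: cPhi.1.
  - exact: (Phi_norm i).
  - exact: cvg_cst.
rewrite (@cdf_sumE _ i) //; apply: (cvg_trans _ H); apply: near_eq_cvg; near=> n.
rewrite (@cdf_sumE _ i) //; near: n.
by have /cvgr_gt := lamc i; apply.
Unshelve. all: by end_near. Qed.

Section PairSign.
Variables (lam : I -> R) (i j : I).
Hypothesis lamP : weights lam.
Hypothesis neq_ij : i != j.
Hypothesis lam_j : 0 < lam j.
Hypothesis lam_ij : lam j < lam i.

Let F := cdf_sum lam.
Let h := pair_density lam i j F.
Let dh := pair_slope lam i j F.
Let cF : causal F. Proof. exact: cdf_sum_causal lamP.1 lamP.2. Qed.
Let ch : causal h. Proof. exact: causal_pair_density. Qed.
Let cdh : causal dh. Proof. exact: causal_pair_slope. Qed.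
Let dhP (y : R) : is_derive y 1 h (dh y). Proof. exact: is_derive_pair_density lam_j lam_ij cF y. Qed.
Let h_gt0 y : 0 < y -> 0 < h y.
Proof.
apply: pair_density_gt0 => //.
- by move=> u v; exact: cdf_sum_ndecr.
- by move=> u; exact: cdf_sum_gt0 lamP.1 lamP.2 u.
Qed.
Let hE y : y * h y = \sum_k (alpha + (k == i)%:R + (k == j)%:R) * lam k * esmooth (lam k) h y.
Proof.
apply: pair_density_size_bias => //; first exact: lamP.1.
exact: cdf_sum_size_bias lamP.1 lamP.2.
Qed.

Lemma pair_slope_gt0 x : (forall k, lam k <= lam i + lam j) ->
  0 < x -> x < alpha -> 0 < dh x.
Proof. exact: (density_increasing alpha_gt0 lamP.1 lamP.2 lam_j lam_ij ch cdh dhP h_gt0 hE). Qed.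

Lemma pair_slope_lt0 x :
  (forall k, k != i -> k != j -> 0 < lam k -> lam i + lam j <= lam k + 1 / 2) ->
  alpha + 1 / 2 < x -> dh x < 0.
Proof.
exact: (density_decreasing alpha_gt0 neq_ij lamP.1 lamP.2 lam_j lam_ij ch cdh dhP h_gt0 hE).
Qed.

Lemma pair_slope_lt0_one_large x : (forall k, k != i -> lam k = lam j) ->
  (2 < #|I|)%N -> 1 / 2 < lam i -> alpha + 1 / 2 < x -> dh x < 0.
Proof.
exact: (density_decreasing_one_large alpha_gt0 lamP.1 lamP.2 lam_j lam_ij ch cdh dhP h_gt0 hE).
Qed.

End PairSign.

Section Spread.
Variables (lam : I -> R) (i j : I).
Hypothesis lamP : weights lam.
Hypothesis neq_ij : i != j.
Let s := lam i + lam j.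
Let L z := pairw lam i j z (s - z).
Let L_i z : L z i = z. Proof. by rewrite /L /pairw eqxx. Qed.
Let L_j z : L z j = s - z.
Proof. by rewrite /L /pairw eqxx eq_sym (negPf neq_ij). Qed.
Let L_k z k : k != i -> k != j -> L z k = lam k.
Proof. by move=> ki kj; rewrite /L /pairw (negPf ki) (negPf kj). Qed.

Lemma pairw_id : pairw lam i j (lam i) (s - lam i) = lam.
Proof.
apply/funext => k; rewrite -/(L (lam i)).
have [->|ki] := eqVneq k i; first by rewrite L_i.
have [->|kj] := eqVneq k j; first by rewrite L_j /s addrC addKr.
by rewrite L_k.
Qed.

Lemma pairw_weights z : 0 <= z <= s -> weights (pairw lam i j z (s - z)).
Proof.
move=> /andP[z0 zs]; split=> [k|].
  rewrite /pairw; case: ifP => // _; case: ifP => _; first by rewrite subr_ge0.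
  exact: lamP.1.
rewrite -lamP.2 (bigD1 i) //= [RHS](bigD1 i) //= (bigD1 j) 1?eq_sym //=.
rewrite [in RHS](bigD1 j) 1?eq_sym //= -/(L z) L_i L_j !addrA; congr (_ + _).
  by ring.
by apply: eq_bigr => k /andP[ki kj]; rewrite L_k.
Qed.

(** By [derive_scale] and [esmooth_cdf_sum], the partial derivative in [lam k] is
    [- (alpha / lam k) * (F - esmooth (lam k) F)]; the difference for [i] and [j] is,
    up to the factor, [pair_slope]. *)
Lemma pair_derive (z x : R) : s / 2 < z < s ->
  is_derive z 1 (fun z => cdf_sum (pairw lam i j z (s - z)) x)
    (alpha * (2 * z - s) * pair_slope (pairw lam i j z (s - z)) i j
       (cdf_sum (pairw lam i j z (s - z))) x).
Proof.
move=> /andP[sz zs]; have s0 : 0 < s by move: sz zs; lra.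
have z0 : 0 < z by move: sz s0; lra.
have sz0 : 0 < s - z by rewrite subr_gt0.
have zI : 0 < z < s by rewrite z0.
have [L0 L1] : weights (L z) by apply: pairw_weights; rewrite !ltW.
apply: (is_derive_eq (@is_derive_pair lam i j s x neq_ij z zI)).
rewrite -/(L z) -!cdf_sumE ?L_i ?L_j // -!esmooth_cdf_sum ?L_i ?L_j //.
rewrite /pair_slope L_i L_j; field; rewrite !gt_eqF // subr_gt0; move: sz; lra.
Qed.

Let cont t1 t2 x : 0 < t1 ->
  {within `[t1, t2], continuous (fun z => cdf_sum (pairw lam i j z (s - z)) x)}.
Proof.
move=> t10; apply: continuous_in_subspaceT => z; rewrite inE /= in_itv /= => /andP[tz _].
by apply: continuous_pair; exact: lt_le_trans tz.
Qed.

Lemma spread_increasing t1 t2 x : s / 2 <= t1 -> t1 < t2 -> t2 <= s ->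
  (forall k, lam k <= s) -> 0 < x -> x < alpha ->
  cdf_sum (pairw lam i j t1 (s - t1)) x < cdf_sum (pairw lam i j t2 (s - t2)) x.
Proof.
move=> st1 t12 t2s lam_s x0 xa.
have t10 : 0 < t1 by move: st1 t12 t2s; lra.
apply: (@derive_gt0_lt _ (fun z => cdf_sum (pairw lam i j z (s - z)) x)
  (fun z => alpha * (2 * z - s) * pair_slope (pairw lam i j z (s - z)) i j
       (cdf_sum (pairw lam i j z (s - z))) x)) => //.
- exact: cont.
- by move=> z /andP[z1 z2]; apply: pair_derive; move: st1 z1 z2 t2s; lra.
- move=> z /andP[z1 z2]; have zs : s / 2 < z < s by move: st1 z1 z2 t2s; lra.
  apply: mulr_gt0; first by rewrite mulr_gt0 // subr_gt0; case/andP: zs; lra.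
  apply: pair_slope_gt0 => //; rewrite -?/(L z) ?L_i ?L_j.
  + by apply: pairw_weights; case/andP: zs; lra.
  + by rewrite subr_gt0; case/andP: zs.
  + by case/andP: zs; lra.
  + move=> k; rewrite addrC subrK.
    have [->|ki] := eqVneq k i; first by rewrite L_i; case/andP: zs; lra.
    have [->|kj] := eqVneq k j; first by rewrite L_j; case/andP: zs; lra.
    by rewrite L_k.
Qed.

Lemma spread_decreasing t1 t2 x : s / 2 <= t1 -> t1 < t2 -> t2 <= s ->
  (forall k, k != i -> k != j -> 0 < lam k -> s <= lam k + 1 / 2) ->
  alpha + 1 / 2 < x ->
  cdf_sum (pairw lam i j t2 (s - t2)) x < cdf_sum (pairw lam i j t1 (s - t1)) x.
Proof.
move=> st1 t12 t2s lam_s xa.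
have t10 : 0 < t1 by move: st1 t12 t2s; lra.
rewrite -ltrN2.
apply: (@derive_gt0_lt _ (fun z => - cdf_sum (pairw lam i j z (s - z)) x)
  (fun z => - (alpha * (2 * z - s) * pair_slope (pairw lam i j z (s - z)) i j
       (cdf_sum (pairw lam i j z (s - z))) x))) => //.
- by move=> z; apply: cvgN; exact: cont.
- move=> z /andP[z1 z2]; apply: is_deriveN; apply: pair_derive.
  by move: st1 z1 z2 t2s; lra.
- move=> z /andP[z1 z2]; have zs : s / 2 < z < s by move: st1 z1 z2 t2s; lra.
  rewrite oppr_gt0 pmulr_rlt0; last first.
    by rewrite mulr_gt0 // subr_gt0; case/andP: zs; lra.
  apply: pair_slope_lt0 => //; rewrite -?/(L z) ?L_i ?L_j.
  + by apply: pairw_weights; case/andP: zs; lra.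
  + by rewrite subr_gt0; case/andP: zs.
  + by case/andP: zs; lra.
  + by move=> k ki kj; rewrite L_k // addrC subrK; exact: lam_s.
Qed.

End Spread.

(** * Extremal weights *)

Lemma ex_argmin (Q : pred I) (f : I -> R) k : Q k ->
  exists2 i, Q i & forall k', Q k' -> f i <= f k'.
Proof. by move=> Qk; case: (Order.TotalTheory.arg_minP f Qk) => i Qi H; exists i. Qed.

Definition is_minimizer lam x :=
  weights lam /\ forall mu, weights mu -> cdf_sum lam x <= cdf_sum mu x.
Definition is_maximizer lam x :=
  weights lam /\ forall mu, weights mu -> cdf_sum mu x <= cdf_sum lam x.

Lemma pair_le1 lam i j : weights lam -> i != j -> lam i + lam j <= 1.
Proof.
move=> [l0 <-] ij; rewrite (bigD1 i) //= lerD2l (bigD1 j) 1?eq_sym //= lerDl.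
exact: sumr_ge0.
Qed.

Lemma triple_le1 lam i j k : weights lam -> i != j -> k != i -> k != j ->
  lam i + lam j + lam k <= 1.
Proof.
move=> [l0 <-] ij ki kj; rewrite (bigD1 i) //= (bigD1 j) 1?eq_sym //=.
by rewrite (bigD1 k) ?ki //= !addrA lerDl sumr_ge0.
Qed.

Lemma single_weight lam i : weights lam -> (forall k, k != i -> lam k = 0) ->
  forall k, lam k = (k == i)%:R.
Proof.
move=> [_ l1] H k; have [->|/H//] := eqVneq k i.
by rewrite -l1 (bigD1 i) //= big1 ?addr0.
Qed.

(** Otherwise the largest weight and a smaller one could be brought together. *)
Lemma minimizer_small lam x : 0 < x -> x < alpha -> is_minimizer lam x ->
  forall i j, lam i = lam j.
Proof.
move=> x0 xa [lamP lam_min].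
suff H i : (forall k, lam k <= lam i) -> forall j, lam j = lam i.
  move=> i j; have [m _ mP] := @ex_argmin predT (fun k => - lam k) i isT.
  have mP' k : lam k <= lam m by rewrite -lerN2 mP.
  by rewrite (H m mP' i) (H m mP' j).
move=> iP j; apply/eqP; rewrite eq_le iP /= leNgt; apply/negP => ji.
have ij : i != j by apply: contraTneq ji => ->; rewrite ltxx.
have lj := lamP.1 j.
have := @spread_increasing lam i j lamP ij ((lam i + lam j) / 2) (lam i) x.
rewrite pairw_id // => /(_ _ _ _ _ x0 xa) H.
have : cdf_sum (pairw lam i j ((lam i + lam j) / 2) (lam i + lam j - (lam i + lam j) / 2)) x
    < cdf_sum lam x.
  apply: H => //; [by move: ji; lra|by move: lj; lra|].
  by move=> k; rewrite (le_trans (iP k)) // lerDl.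
rewrite ltNge lam_min //; apply: pairw_weights => //; move: lj ji; lra.
Qed.

(** Otherwise the largest weight could absorb another positive one. *)
Lemma maximizer_small lam x : 0 < x -> x < alpha -> is_maximizer lam x ->
  exists i, forall k, lam k = (k == i)%:R.
Proof.
move=> x0 xa [lamP lam_max].
have [k0 _] := some_lam_gt0 lamP.1 lamP.2.
have [i _ iP] := @ex_argmin predT (fun k => - lam k) k0 isT.
have iP' k : lam k <= lam i by rewrite -lerN2 iP.
exists i; apply: single_weight => // j ji; apply/eqP; rewrite eq_le lamP.1 andbT leNgt.
apply/negP => lj; have ij : i != j by rewrite eq_sym.
have := @spread_increasing lam i j lamP ij (lam i) (lam i + lam j) x.
rewrite pairw_id // => /(_ _ _ _ _ x0 xa) H.
have : cdf_sum lam x <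
    cdf_sum (pairw lam i j (lam i + lam j) (lam i + lam j - (lam i + lam j))) x.
  apply: H => //; [by move: (iP' j); lra|by rewrite ltrDl|].
  by move=> k; rewrite (le_trans (iP' k)) // lerDl ltW.
rewrite ltNge lam_max //; apply: pairw_weights => //; move: (iP' j) lj; lra.
Qed.

(** Otherwise the two smallest positive weights [j] and [i] could be merged: a third
    positive weight [k] is at least [lam i], and [lam i + lam j + lam k <= 1], so
    [lam j <= 1 / 2] and [lam i + lam j <= lam k + 1 / 2]. *)
Lemma minimizer_large lam x : alpha + 1 / 2 < x -> is_minimizer lam x ->
  exists i, forall k, lam k = (k == i)%:R.
Proof.
move=> xa [lamP lam_min].
have [k0 lk0] := some_lam_gt0 lamP.1 lamP.2.
have [j lj jP] := @ex_argmin (fun k => 0 < lam k) lam k0 lk0.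
have [[k1 /andP[k1j lk1]]|no] := pselect (exists k, (k != j) && (0 < lam k)); last first.
  exists j; apply: single_weight => // k kj; apply/eqP; rewrite eq_le lamP.1 andbT leNgt.
  by apply/negP => lk; apply: no; exists k; rewrite kj.
have [i /andP[ij li] iP] := @ex_argmin (fun k => (k != j) && (0 < lam k)) lam k1 (introT andP (conj k1j lk1)).
exfalso; have lji := jP i li.
have := @spread_decreasing lam i j lamP ij (lam i) (lam i + lam j) x.
rewrite pairw_id // => /(_ _ _ _ _ xa) H.
have : cdf_sum (pairw lam i j (lam i + lam j) (lam i + lam j - (lam i + lam j))) x
    < cdf_sum lam x.
  apply: H => //; [by move: lji; lra|by rewrite ltrDl|].
  move=> k ki kj lk; have := triple_le1 lamP ij ki kj.
  by have := iP k (introT andP (conj kj lk)); move: lji; lra.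
rewrite ltNge lam_min //; apply: pairw_weights => //; move: li lj; lra.
Qed.

(** Otherwise bring together the smallest weight [j] and the smallest weight [i] above
    it.  This raises the value unless some other positive [lam k] is below
    [lam i + lam j - 1 / 2]; then [lam k = lam j] and [1 / 2 < lam i], which forces all
    weights but [lam i] to equal [lam j].  There only the derivative at the given
    weights is known, and a small move is used. *)
Lemma maximizer_large lam x : alpha + 1 / 2 < x -> is_maximizer lam x ->
  forall i j, lam i = lam j.
Proof.
move=> xa [lamP lam_max].
suff H j : (forall k, lam j <= lam k) -> forall k, lam k = lam j.
  move=> i j; have [m _ mP] := @ex_argmin predT lam i isT.
  by rewrite (H m (fun k => mP k isT) i) (H m (fun k => mP k isT) j).
move=> jP k1; apply/eqP; rewrite eq_le jP andbT leNgt; apply/negP => k1P.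
have [i ji iP] := @ex_argmin (fun k => lam j < lam k) lam k1 k1P.
have ij : i != j by apply: contraTneq ji => ->; rewrite ltxx.
have lj := lamP.1 j; have s1 := pair_le1 lamP ij.
have [cond|] := pselect (forall k, k != i -> k != j -> 0 < lam k ->
    lam i + lam j <= lam k + 1 / 2).
  have := @spread_decreasing lam i j lamP ij ((lam i + lam j) / 2) (lam i) x.
  rewrite pairw_id // => /(_ _ _ _ cond xa) H.
  have : cdf_sum lam x <
      cdf_sum (pairw lam i j ((lam i + lam j) / 2) (lam i + lam j - (lam i + lam j) / 2)) x.
    by apply: H => //; [move: ji; lra|move: lj; lra].
  by rewrite ltNge lam_max //; apply: pairw_weights => //; move: lj ji; lra.
move=> /existsNP[k /not_implyP[ki /not_implyP[kj /not_implyP[lk /negP]]]].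
rewrite -ltNge => lki.
have kj_eq : lam k = lam j.
  apply/eqP; rewrite eq_le jP andbT leNgt; apply/negP => jk.
  by have := iP k jk; move: lki ji s1; lra.
have lj0 : 0 < lam j by rewrite -kj_eq.
have li2 : 1 / 2 < lam i by move: lki; rewrite kj_eq; lra.
have others_eq k' : k' != i -> lam k' = lam j.
  move=> k'i; apply/eqP; rewrite eq_le jP andbT leNgt; apply/negP => jk'.
  have := iP k' jk'; have := @pair_le1 lam i k' lamP; rewrite eq_sym k'i => /(_ isT).
  by move: li2; lra.
have card3 : (2 < #|I|)%N.
  by rewrite (cardD1 i) (cardD1 j) (cardD1 k) !inE (eq_sym j i) ij ki kj.
have slope := pair_slope_lt0_one_large lamP lj0 ji others_eq card3 li2 xa.
have lis : (lam i + lam j) / 2 < lam i < lam i + lam j by move: lj0 ji; lra.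
have := @pair_derive lam i j lamP ij (lam i) x lis; rewrite pairw_id // => dG.
have [|e e0 He] := derive_lt0_near dG.
  by rewrite pmulr_rlt0 // mulr_gt0 // subr_gt0; move: ji; lra.
pose t := lam i - Num.min e (lam i) / 2.
have [m1 m2] : Num.min e (lam i) <= e /\ Num.min e (lam i) <= lam i.
  by rewrite !ge_min !lexx orbT.
have mi : 0 < Num.min e (lam i) by rewrite lt_min e0 (lt_trans lj0).
have : cdf_sum lam x < cdf_sum (pairw lam i j t (lam i + lam j - t)) x.
  rewrite -{1}(pairw_id lam ij); apply: (He t).2.
  by rewrite /t; move: m1 mi e0; lra.
rewrite ltNge lam_max //; apply: pairw_weights => //; rewrite /t; move: m2 mi lj0; lra.
Qed.

End WeightedSum.

(** * Existence of extremal weights *)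

Section Existence.
Context {R : realType} (n : nat).

Lemma seq_continuous_within (f : 'rV[R]_n.+1 -> R) (A : set 'rV[R]_n.+1) v :
  (forall u : nat -> 'rV[R]_n.+1, (forall m, A (u m)) -> u m @[m --> \oo] --> v ->
     f (u m) @[m --> \oo] --> f v) ->
  f w @[w --> within A (nbhs v)] --> f v.
Proof.
move=> H; apply/cvgrPdist_le => e e0; apply: contrapT => nH.
have step m : exists y, [/\ A y, ball v m.+1%:R^-1 y & ~ `|f v - f y| <= e].
  apply: contrapT => no; apply: nH; rewrite near_withinE; apply/nbhs_ballP.
  exists m.+1%:R^-1 => /=; first by rewrite invr_gt0 ltr0n.
  move=> y vy Ay; apply: contrapT => fy; apply: no; by exists y.
have [u uP] := choice step.
have Au m : A (u m) by have [] := uP m.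
have uv : u m @[m --> \oo] --> v.
  apply/cvg_ballP => d d0.
  have : \forall m \near \oo, (m.+1%:R^-1 : R) < d by exact: near_infty_natSinv_lt (PosNum d0).
  apply: filterS => m md; have [_ + _] := uP m.
  by apply: le_ball; exact: ltW.
have /cvgrPdist_le/(_ e e0)[m _ Hm] := H u Au uv.
by have [_ _] := uP m; apply; exact: Hm (leqnn m).
Qed.

Let entries (v : 'rV[R]_n.+1) (k : 'I_n.+1) : R := v ord0 k.

Lemma weights_compact : compact [set v | weights (entries v)].
Proof.
have cbox := @rV_compact R^o n.+1 (fun=> `[0, 1]%classic) (fun=> @segment_compact R 0 1).
apply: (subclosed_compact _ cbox).
  rewrite (_ : [set v | weights (entries v)] =
    (\bigcap_k ((fun v : 'rV[R]_n.+1 => v ord0 k) @^-1` [set y : R | 0 <= y])) `&`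
    ((fun v : 'rV[R]_n.+1 => \sum_k v ord0 k) @^-1` [set y : R | y = 1])).
    apply: closedI.
      apply: closed_bigI => k _; apply: closed_comp; last exact: closed_ge.
      by move=> v _; exact: coord_continuous.
    apply: closed_comp; last exact: closed_eq.
    by move=> v _; apply: continuous_fsum => k _; exact: coord_continuous.
  apply/seteqP; split=> v /=.
    by move=> [v0 v1]; split=> // k _; exact: v0.
  by move=> [v0 v1]; split=> // k; exact: v0.
move=> v [v0 v1] k /=; rewrite in_itv /= v0 /= -v1 (bigD1 k) //= lerDl.
by apply: sumr_ge0.
Qed.

Lemma weights_nonempty : [set v | weights (entries v)] !=set0.
Proof.
exists (\row_k (k == ord0)%:R); split=> [k|]; first by rewrite /entries mxE.
rewrite (bigD1 ord0) //= /entries mxE eqxx big1 ?addr0 // => k /negPf k0.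
by rewrite mxE k0.
Qed.

Lemma weights_argmin (f : ('I_n.+1 -> R) -> R) :
  (forall lamn lam, weights lam -> (forall k, lamn m k @[m --> \oo] --> lam k) ->
     f (lamn m) @[m --> \oo] --> f lam) ->
  exists2 lam, weights lam & forall mu, weights mu -> f lam <= f mu.
Proof.
move=> fc.
have cf : {within [set v | weights (entries v)], continuous (f \o entries)}.
  apply/subspace_continuousP => v vA; apply: seq_continuous_within => u uA uv.
  apply: fc => // k; apply: (@continuous_cvg _ _ _ _ _ _ (fun v : 'rV[R]_n.+1 => v ord0 k)) => //.
  exact: coord_continuous.
have [v vA vmin] := EVT_min_rV weights_nonempty weights_compact cf.
exists (entries v); first by rewrite inE in vA.
move=> mu mu_w; have muE : entries (\row_k mu k) = mu.
  by apply/funext => k; rewrite /entries mxE.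
by have := vmin (\row_k mu k); rewrite inE /= muE; apply.
Qed.

End Existence.

(** * From the gamma law of rate [beta] to rate 1 *)

Section GammaLaw.
Context d (T : measurableType d) (R : realType) (P : probability T R).
Context (X : {RV P >-> R}) (alpha beta : R).
Hypothesis beta_gt0 : 0 < beta.
Hypothesis X_gamma : gamma_distributed alpha beta X.

Let pdf := gamma_pdf alpha beta.
Let mu := @lebesgue_measure R.

(** The distribution function of [beta * X]. *)
Definition gamma_cdf (t : R) : R := \int[mu]_(y in `]-oo, t / beta]) pdf y.

Definition gamma_const : R :=
  beta `^ alpha / Gamma_fun alpha * beta^-1 `^ (alpha - 1) / beta.

Let pdfE y : pdf y = if 0 <= y
  then beta `^ alpha / Gamma_fun alpha * y `^ (alpha - 1) * expR (- beta * y) else 0.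
Proof. by rewrite /pdf /gamma_pdf patchE mem_setE in_itv /= andbT. Qed.

Let Gamma_ge0 : 0 <= Gamma_fun alpha.
Proof. by apply: Rintegral_ge0 => y _; rewrite mulr_ge0 ?powR_ge0 ?expR_ge0. Qed.

Let pdf_ge0 y : 0 <= pdf y.
Proof.
rewrite pdfE; case: ifP => // _.
by rewrite !mulr_ge0 ?powR_ge0 ?expR_ge0 ?invr_ge0.
Qed.

Let measurable_pdf : measurable_fun setT pdf.
Proof.
apply/(measurable_restrictT _ (measurable_itv _)); apply: measurable_funTS.
apply: measurable_funM; last by apply: measurableT_comp => //; exact: measurable_funM.
by apply: measurable_funM => //; exact: measurable_powR.
Qed.

Let law V : measurable V -> P (X @^-1` V) = (\int[mu]_(y in V) (pdf y)%:E)%E.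
Proof. exact: X_gamma. Qed.

Let pdf_total : (\int[mu]_y (pdf y)%:E = 1)%E.
Proof. by rewrite -law // preimage_setT probability_setT. Qed.

Let integrable_pdf : mu.-integrable setT (EFin \o pdf).
Proof.
apply/integrableP; split; first exact/measurable_EFinP.
have -> : (\int[mu]_y `|(EFin \o pdf) y| = \int[mu]_y (pdf y)%:E)%E.
  by apply: eq_integral => y _ /=; rewrite ger0_norm.
by rewrite pdf_total ltry.
Qed.

Let integrable_pdf_on D : measurable D -> mu.-integrable D (EFin \o pdf).
Proof. by move=> mD; exact: integrableS integrable_pdf. Qed.

(** A vanishing value would make the density 0, whereas its total mass is 1. *)
Lemma Gamma_gt0 : 0 < Gamma_fun alpha.
Proof.
rewrite lt_neqAle Gamma_ge0 andbT eq_sym; apply/eqP => G0.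
have : (\int[mu]_y (pdf y)%:E = 0)%E.
  rewrite -[RHS](integral0 mu setT); apply: eq_integral => y _.
  by rewrite pdfE G0 invr0 mulr0 !mul0r if_same.
by rewrite pdf_total => /eqP; rewrite onee_eq0.
Qed.

Lemma gamma_const_gt0 : 0 < gamma_const.
Proof. by rewrite /gamma_const !(divr_gt0, mulr_gt0) ?powR_gt0 ?invr_gt0 ?Gamma_gt0. Qed.

Let closed_law r : P (X @^-1` `]-oo, r]) = (\int[mu]_(y in `]-oo, r]) pdf y)%:E.
Proof.
rewrite law // /Rintegral fineK //; apply: integrable_fin_num => //.
exact: integrable_pdf_on.
Qed.

Lemma gamma_lt r : P [set w | X w < r] = (\int[mu]_(y in `]-oo, r]) pdf y)%:E.
Proof.
rewrite -Rintegral_itv_bndo_bndc; last exact: integrable_pdf_on.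
rewrite (_ : [set w | X w < r] = X @^-1` `]-oo, r[); last first.
  by apply/seteqP; split=> w /=; rewrite in_itv.
rewrite law // /Rintegral fineK //; apply: integrable_fin_num => //.
exact: integrable_pdf_on.
Qed.

Let gamma_cdf_eq t : gamma_cdf t = fine (cdf X (t / beta)).
Proof. by rewrite /cdf /distribution /pushforward closed_law. Qed.

Lemma gamma_cdf0 t : t <= 0 -> gamma_cdf t = 0.
Proof.
move=> t0; rewrite /gamma_cdf -Rintegral_itv_bndo_bndc; last exact: integrable_pdf_on.
rewrite (@eq_Rintegral _ _ _ _ _ (cst 0)).
  by rewrite Rintegral_cst // mul0r.
move=> y; rewrite inE /= in_itv /= => yt; rewrite pdfE leNgt (lt_le_trans yt) //.
by rewrite mulr_le0_ge0 // invr_ge0 ltW.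
Qed.

Lemma gamma_cdf_derive (t : R) : 0 < t ->
  is_derive t 1 gamma_cdf (gamma_const * t `^ (alpha - 1) * expR (- t)).
Proof.
move=> t0; have tb : 0 < t / beta by rewrite divr_gt0.
have tb1 : t / beta < t / beta + 1 by rewrite ltrDl.
have ct : {for t / beta, continuous pdf}.
  have c2 : {for t / beta, continuous (fun y : R =>
      beta `^ alpha / Gamma_fun alpha * y `^ (alpha - 1) * expR (- beta * y))}.
    have ? := is_derive1_powR (alpha - 1) tb.
    have dl : is_derive (t / beta) 1 (fun y => - beta * y) (- beta).
      by apply: is_derive_eq; rewrite /GRing.scale /=; ring.
    have ? := @is_derive1_comp _ expR (fun y => - beta * y) (t / beta) _ _ (is_derive_expR _) dl.
    apply: is_derive_continuous; exact: is_deriveM.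
  apply: (cvg_trans _ (_ : _ --> pdf (t / beta))); last first.
    by rewrite pdfE (ltW tb); exact: c2.
  apply: near_eq_cvg; near=> y; rewrite pdfE; case: ifP => //.
  by move/negP; case; apply/ltW; near: y; exact: lt_nbhsr.
have H := @continuous_FTC1 R pdf (BInfty _ true) (t / beta) (t / beta + 1) tb1
  (integrable_pdf_on (measurable_itv _)) (ltNyr _) ct.
have [D dE] := H.
have d1 : is_derive (t / beta) 1 (fun x => \int[mu]_(y in `]-oo, x]) pdf y) (pdf (t / beta)).
  by apply: (DeriveDef D); rewrite -derive1E.
have dl : is_derive t 1 (fun t => t / beta) beta^-1.
  by apply: is_derive_eq; rewrite /GRing.scale /=; ring.
apply: (is_derive_eq (@is_derive1_comp _ _ (fun t => t / beta) t _ _ d1 dl)).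
rewrite pdfE (ltW tb) /gamma_const powRM ?invr_ge0 ?ltW //.
have -> : - beta * (t / beta) = - t by field; rewrite gt_eqF.
by ring.
Unshelve. all: by end_near. Qed.

(** Continuity at 0, where the density may be unbounded, comes from the right
    continuity of distribution functions. *)
Lemma gamma_cdf_causal : causal gamma_cdf.
Proof.
split=> [t|]; last exact: gamma_cdf0.
have [t0|t0|->] := ltgtP t 0.
- apply: (cvg_trans _ (_ : cst 0 y @[y --> t] --> gamma_cdf t)); last first.
    by rewrite gamma_cdf0 ?ltW //; exact: cvg_cst.
  apply: near_eq_cvg; near=> y; rewrite gamma_cdf0 //; apply/ltW.
  by near: y; exact: lt_nbhsl.
- exact: is_derive_continuous (gamma_cdf_derive t0).
have cr : gamma_cdf y @[y --> 0^'+] --> gamma_cdf 0.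
  have /fine_cvgP[_ rc] : cdf X y @[y --> 0^'+] --> (fine (cdf X 0))%:E.
    rewrite fineK ?fin_num_measure //.
    exact (@cdf_right_continuous _ _ _ P X 0).
  have -> : gamma_cdf 0 = fine (cdf X 0) by rewrite gamma_cdf_eq mul0r.
  apply/cvg_at_rightP => u [u0 uc].
  have -> : (fun m => gamma_cdf (u m)) = fun m => (fine \o cdf X) (u m / beta).
    by apply/funext => m; rewrite /= gamma_cdf_eq.
  move/cvg_at_rightP : rc => /(_ (fun m => u m / beta)); apply; split.
    by move=> m; rewrite divr_gt0.
  by rewrite -[X in _ --> X](mul0r beta^-1); apply: cvgM => //; exact: cvg_cst.
have cl : gamma_cdf y @[y --> 0^'-] --> gamma_cdf 0.
  have E : {near 0^'-, (cst 0 : R -> R) =1 gamma_cdf}.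
    near=> y; have y0 : y < 0 by near: y; exact: nbhs_left_lt.
    by rewrite gamma_cdf0 // ltW.
  apply: (cvg_trans (near_eq_cvg E)); rewrite gamma_cdf0 //; exact: cvg_cst.
exact/left_right_continuousP.
Unshelve. all: by end_near. Qed.

Lemma gamma_cdf_gt0 t : 0 < t -> 0 < gamma_cdf t.
Proof.
move=> t0; rewrite -(gamma_cdf0 (lexx 0)).
apply: (derive_gt0_lt t0 _ (fun x xt => gamma_cdf_derive (proj1 (andP xt)))).
- by apply: continuous_subspaceT; case: gamma_cdf_causal.
- move=> x /andP[x0 _].
  exact: (mulr_gt0 (mulr_gt0 gamma_const_gt0 (powR_gt0 _ x0)) (expR_gt0 _)).
Qed.

End GammaLaw.

Section PositiveScaling.
Context d (T : measurableType d) (R : realType).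

Definition pos_scale (b : R) (X : {mfun T >-> R}) (w : T) : R := Num.max (b * X w) 0.

Lemma measurable_pos_scale b X : measurable_fun setT (pos_scale b X).
Proof. by apply: measurable_maxr => //; exact: measurable_funM. Qed.

HB.instance Definition _ b X :=
  isMeasurableFun.Build _ _ _ _ (pos_scale b X) (measurable_pos_scale b X).

End PositiveScaling.

Section Reduction.
Context d (T : measurableType d) (R : realType) (P : probability T R).
Context (I : finType) (X : I -> {RV P >-> R}) (alpha beta : R).
Hypothesis alpha_gt0 : 0 < alpha.
Hypothesis beta_gt0 : 0 < beta.
Hypothesis X_indep : mutually_independent X.
Hypothesis X_gamma : forall k, gamma_distributed alpha beta (X k).

Definition scaled k : {RV P >-> R} := pos_scale beta (X k) : {mfun T >-> R}.

Lemma scaled_ge0 k w : 0 <= scaled k w.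
Proof. by rewrite /scaled /pos_scale /= le_max lexx orbT. Qed.

Lemma scaled_indep : mutually_independent scaled.
Proof.
move=> J B mB; pose g (y : R) := Num.max (beta * y) 0.
have mg : measurable_fun setT g by apply: measurable_maxr => //; exact: measurable_funM.
apply: (X_indep J (B := fun k => g @^-1` B k)) => k.
by rewrite -[X in measurable X]setTI; exact: mg.
Qed.

Lemma scaled_cdf k t : P [set w | scaled k w < t] = (gamma_cdf alpha beta t)%:E.
Proof.
have [t0|t0] := leP t 0.
  rewrite (gamma_cdf0 beta_gt0 (X_gamma k) t0) (_ : [set w | _] = set0) ?measure0 //.
  apply/seteqP; split=> w //=; apply/negP; rewrite -leNgt (le_trans t0) //.
  exact: scaled_ge0.
rewrite /gamma_cdf -(gamma_lt (X_gamma k)); congr (P _).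
apply/seteqP; split=> w /=; rewrite /scaled /pos_scale /= gt_max t0 andbT;
  by rewrite ltr_pdivlMr // mulrC.
Qed.

Let nonneg k : P (X k @^-1` `[0, +oo[) = 1%E.
Proof.
have X0 : P [set w | X k w < 0] = 0%E.
  by rewrite (gamma_lt (X_gamma k)) -[0](mul0r beta^-1) -/(gamma_cdf alpha beta 0)
    (gamma_cdf0 beta_gt0 (X_gamma k)).
have -> : X k @^-1` `[0, +oo[ = ~` [set w | X k w < 0].
  apply/seteqP; split=> w /=; rewrite in_itv /= andbT leNgt; [by move/negP|by move=> /negP].
by rewrite probability_setC ?X0 ?sube0 //; exact: measurable_below.
Qed.

Let pos_event := \bigcap_(k in [set` [set: I]%SET]) X k @^-1` `[0, +oo[.

Let measurable_pos_event : measurable pos_event.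
Proof.
apply: fin_bigcap_measurable => // k _.
by rewrite -[X in measurable X]setTI; exact: measurable_funP.
Qed.

Let pos_event1 : P (~` pos_event) = 0%E.
Proof.
rewrite probability_setC // /pos_event X_indep //.
by rewrite big1 ?subee // => k _; exact: nonneg.
Qed.

(** The weighted sums of [beta * X] and of its positive parts agree on the event,
    of probability 1, that all [X k] are nonnegative. *)
Lemma scaled_sum lam x : weights lam ->
  P [set w | \sum_k lam k * X k w < x] = (cdf_sum scaled lam (beta * x))%:E.
Proof.
move=> [lam0 _]; rewrite -sum_cdfE.
pose A := [set w | \sum_k lam k * X k w < x].
pose B := [set w | \sum_k lam k * scaled k w < beta * x].
have mA : measurable A by exact: measurable_sum_below.
have mB : measurable B by exact: measurable_sum_below.
have BA : B `<=` A.
  move=> w; rewrite /A /B /= => wB; rewrite -(ltr_pM2l beta_gt0) (le_lt_trans _ wB) //.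
  rewrite mulr_sumr; apply: ler_sum => k _; rewrite mulrCA ler_wpM2l //.
  by rewrite /scaled /pos_scale /= le_max lexx.
have AB : A `<=` B `|` ~` pos_event.
  move=> w wA; have [wp|wp] := pselect (pos_event w); last by right.
  left; rewrite /B /=; move: wA; rewrite /A /= -(ltr_pM2l beta_gt0).
  rewrite mulr_sumr; congr (_ < _); apply: eq_bigr => k _; rewrite mulrCA.
  rewrite /scaled /pos_scale /=; have := wp k; rewrite /= finset.in_setT in_itv /= andbT.
  by move=> /(_ isT) X0; rewrite max_l // mulr_ge0 // ltW.
apply/eqP; rewrite eq_le; apply/andP; split.
  apply: (@le_trans _ _ (P (B `|` ~` pos_event))).
    by apply: le_measure; rewrite ?inE //; apply: measurableU => //; exact: measurableC.
  apply: (le_trans (measureU2 _ mB (measurableC measurable_pos_event))).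
  have : (P B + P (~` pos_event) <= P B)%E by rewrite pos_event1 adde0.
  by [].
by apply: le_measure; rewrite ?inE.
Qed.

End Reduction.

(** * Minimum and maximum over the simplex *)

Theorem theorem2 (R : realType) (d : measure_display) (T : measurableType d)
    (P : probability T R) (n : nat) (X : 'I_n.+1 -> {RV P >-> R})
    (alpha beta : R) (alpha_gt0 : 0 < alpha) (beta_gt0 : 0 < beta)
    (X_indep : mutually_independent X)
    (X_gamma : forall i, gamma_distributed alpha beta (X i)) (x : R) :
  [/\ is_min (prob_lin_lt X x @` Theta R n.+1) (m_n X x),
      is_max (prob_lin_lt X x @` Theta R n.+1) (M_n X x),
      x < alpha / beta ->
        m_n X x = P [set w | n.+1%:R^-1 * (\sum_(i < n.+1) X i w) < x] /\
        M_n X x = P [set w | X ord0 w < x] &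
      (2 * alpha + 1) / (2 * beta) < x ->
        m_n X x = P [set w | X ord0 w < x] /\
        M_n X x = P [set w | n.+1%:R^-1 * (\sum_(i < n.+1) X i w) < x] ].
Proof.
pose Y := scaled X beta; pose Phi := gamma_cdf alpha beta.
pose v lam := cdf_sum Y lam (beta * x).
have Y0 : forall k w, 0 <= Y k w by exact: scaled_ge0.
have Yind : mutually_independent Y by exact: scaled_indep.
have cPhi : causal Phi by exact: gamma_cdf_causal beta_gt0 (X_gamma ord0).
have YPhi : forall k t, P [set w | Y k w < t] = (Phi t)%:E by move=> k t; exact: scaled_cdf.
have dPhi (t : R) : 0 < t ->
    is_derive t 1 Phi (gamma_const alpha beta * t `^ (alpha - 1) * expR (- t)).
  exact: gamma_cdf_derive beta_gt0 (X_gamma ord0) t.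
have Phi_gt0 t : 0 < t -> 0 < Phi t by exact: gamma_cdf_gt0 beta_gt0 (X_gamma ord0) t.
have value lam : weights lam ->
    P [set w | \sum_k lam k * X k w < x] = (v lam)%:E by exact: scaled_sum.
have v_cvg lamn lam : weights lam -> (forall k, lamn m k @[m --> \oo] --> lam k) ->
    v (lamn m) @[m --> \oo] --> v lam.
  by move=> lamW lamc; exact: (cdf_sum_cvg Yind cPhi YPhi lamW lamc).
have [lmin lminW lminP] := weights_argmin v_cvg.
have [lmax lmaxW lmaxP] : exists2 lam, weights lam & forall mu, weights mu -> v mu <= v lam.
  have [|lam lamW lamP] := @weights_argmin R n (fun lam => - v lam).
    by move=> lamn lam lamW lamc; apply: cvgN; exact: v_cvg.
  by exists lam => // mu muW; rewrite -lerN2 lamP.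
have attained lam : weights lam -> (prob_lin_lt X x @` Theta R n.+1) (v lam)%:E.
  move=> lamW; pose c : 'cV[R]_n.+1 := \col_k lam k.
  have cE k : c k ord0 = lam k by rewrite mxE.
  exists c; first split=> [k|].
  - by rewrite cE; exact: lamW.1.
  - by rewrite (eq_bigr lam) => [|k _]; [exact: lamW.2|rewrite cE].
  have sumE w : \sum_k c k ord0 * X k w = \sum_k lam k * X k w.
    by apply: eq_bigr => k _; rewrite cE.
  by rewrite /prob_lin_lt -value //; congr (P _); apply/seteqP; split=> w /=; rewrite sumE.
have is_minP : is_min (prob_lin_lt X x @` Theta R n.+1) (v lmin)%:E.
  split; first exact: attained.
  by move=> _ [lam lamT <-]; rewrite /prob_lin_lt value // lee_fin lminP.
have is_maxP : is_max (prob_lin_lt X x @` Theta R n.+1) (v lmax)%:E.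
  split; first exact: attained.
  by move=> _ [lam lamT <-]; rewrite /prob_lin_lt value // lee_fin lmaxP.
have mE : m_n X x = (v lmin)%:E.
  apply/eqP; rewrite eq_le (ereal_inf_lbound is_minP.1).
  exact: le_ereal_inf_tmp is_minP.2.
have ME : M_n X x = (v lmax)%:E.
  by apply/eqP; rewrite eq_le (ereal_sup_ubound is_maxP.1) (ge_ereal_sup is_maxP.2).
have mean_value lam : weights lam -> (forall i j, lam i = lam j) ->
    (v lam)%:E = P [set w | n.+1%:R^-1 * (\sum_(i < n.+1) X i w) < x].
  move=> lamW lam_cst; have lamE k : lam k = n.+1%:R^-1.
    have := lamW.2; rewrite (eq_bigr (fun=> lam k)) => [|i _]; last exact: lam_cst.
    rewrite sumr_const card_ord -(mulr_natr (lam k)) => E.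
    by rewrite -[RHS]div1r; apply: (canRL (mulfK _) E); rewrite pnatr_eq0.
  have sumE w : \sum_k lam k * X k w = n.+1%:R^-1 * \sum_k X k w.
    by rewrite mulr_sumr; apply: eq_bigr => k _; rewrite lamE.
  by rewrite -value //; congr (P _); apply/seteqP; split=> w /=; rewrite sumE.
have single_value lam : weights lam -> (exists i, forall k, lam k = (k == i)%:R) ->
    (v lam)%:E = P [set w | X ord0 w < x].
  move=> lamW [i lamE]; rewrite -value // (gamma_lt (X_gamma ord0)) -(gamma_lt (X_gamma i)).
  congr (P _); apply/seteqP; split=> w /=; rewrite (bigD1 i) //= lamE eqxx mul1r;
    by rewrite big1 ?addr0 // => k /negPf ki; rewrite lamE ki mul0r.
have min_v : is_minimizer Y lmin (beta * x) by [].
have max_v : is_maximizer Y lmax (beta * x) by [].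
rewrite mE ME; split=> //.
- rewrite ltr_pdivlMr // (mulrC x) => xa.
  (* For [x <= 0] all values are 0, and any weights of the two kinds will do. *)
  have [x0|x0] := leP (beta * x) 0.
    have v0 lam : weights lam -> v lam = 0.
      by move=> [l0 l1]; apply: (cdf_sum_causal Yind Y0 cPhi YPhi l0 l1).2.
    pose unit_w (k : 'I_n.+1) : R := (k == ord0)%:R.
    pose unif_w (k : 'I_n.+1) : R := n.+1%:R^-1.
    have unit_W : weights unit_w.
      split=> [k|]; first exact: ler0n.
      by rewrite (bigD1 ord0) //= /unit_w eqxx big1 ?addr0 // => k /negPf->.
    have unif_W : weights unif_w.
      split=> [k|]; first by rewrite invr_ge0.
      by rewrite sumr_const card_ord -(mulr_natr n.+1%:R^-1) mulVf ?pnatr_eq0.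
    rewrite -(mean_value unif_w) // -(single_value unit_w) ?v0 //.
    by exists ord0.
  split.
    by apply: mean_value => //; exact: (minimizer_small alpha_gt0 Yind Y0 cPhi YPhi dPhi Phi_gt0 x0 xa min_v).
  by apply: single_value => //; exact: (maximizer_small alpha_gt0 Yind Y0 cPhi YPhi dPhi Phi_gt0 x0 xa max_v).
- have -> : (2 * alpha + 1) / (2 * beta) = (alpha + 1 / 2) / beta.
    by field; rewrite gt_eqF.
  rewrite ltr_pdivrMr // (mulrC x) => xa.
  split.
    by apply: single_value => //; exact: (minimizer_large alpha_gt0 Yind Y0 cPhi YPhi dPhi Phi_gt0 xa min_v).
  by apply: mean_value => //; exact: (maximizer_large alpha_gt0 Yind Y0 cPhi YPhi dPhi Phi_gt0 xa max_v).
Qed.
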